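(* Let $A_n=\frac{1}{\sqrt n}(a_{jk})_{j,k=1}^n$ be a matrix from the Gaussian Unitary Ensemble, i.e. a Hermitian $n\times n$ matrix with $\{\Re a_{jk}=\Re a_{kj}\}_{j<k}$ and $\{\Im a_{jk}=-\Im a_{kj}\}_{j<k}$ i.i.d. $N(0,1/2)$ random variables and $\{a_{ii}\}_{1\le i\le n}$ i.i.d. $N(0,1)$ random variables, all independent. For $z\in\mathbb{C}$ with $\Im z\neq 0$ set $G_n(z)=(A_n-2-z n^{-2/3})^{-1}$ (where $A_n-w$ means $A_n-w\,\mathrm{Id}$), $g_{n,k}(z)=n^{-2k/3}\,\mathrm{Tr}\,G_n^k(z)$ for integers $k\ge 2$, and $g^c_{n,1}(z)=n^{-2/3}\left(n+\mathrm{Tr}\,G_n(z)\right)$. For a multi-index $K=(k_1,\dots,k_j)$, $j\ge1$, of nonnegative integers, let $$m_K=\mathbb{E}\Big((g^c_{n,1}(z))^{k_1}\prod_{l=2}^j (g_{n,l}(z))^{k_l}\Big),$$ and let $e_l$ denote the multi-index whose $l$-th component is $1$ and all other components are $0$. Then for every non-zero multi-index $K$, $$m_K\,(z+O(n^{-2/3}))-m_{K+2e_1}(1+O(n^{-2/3}))-\sum_{l\ge1} l\,k_l\, m_{K-e_l+e_{l+2}}(1+O(n^{-2/3}))=O(n^{-1/3})\,m_{K+e_1},$$ where the term $k_l\, m_{K-e_l+e_{l+2}}$ is interpreted as $0$ when $k_l=0$. Moreover, the following boundary condition holds: $$z+O(n^{-2/3})-m_{2e_1}(1+O(n^{-2/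3}))=O(n^{-1/3})\,m_{e_1}.$$
   Context: Multi-indices are added componentwise, extending by zero components as needed (a component beyond the length of a multi-index is $0$, i.e. the corresponding factor is absent from $m_K$). The symbols $O(n^{-a})$ denote (possibly different) quantities, as $n\to\infty$, bounded in absolute value by a constant times $n^{-a}$. *)

(* Defs.v *)
From HB Require Import structures.
From mathcomp Require Import all_boot all_order all_algebra.
From mathcomp Require Import all_classical all_reals all_analysis.
From mathcomp Require Import complex.
Set Implicit Arguments. Unset Strict Implicit. Unset Printing Implicit Defensive.
Import Order.TTheory GRing.Theory Num.Theory.
Local Open Scope classical_set_scope.
Local Open Scope ring_scope.

Section GUE.
Context {R : realType} {d : measure_display} {T : measurableType d}
  (P : probability T R).

Definition mutually_independent (I : finType) (S : {set I})
    (X : I -> T -> R) : Prop :=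
  forall (J : {set I}) (B : I -> set R),
    J \subset S -> (forall i, measurable (B i)) ->
    P [set t | forall i, i \in J -> B i (X i t)] =
      (\prod_(i in J) P (X i @^-1` B i))%E.

(* X has the law N(0, s^2) (s = standard deviation) *)
Definition has_normal_law (s : R) (X : {RV P >-> R}) : Prop :=
  forall A : set R, measurable A -> distribution P X A = normal_prob 0 s A.

(* GUE entries (unnormalized) of size n: x j k = Re a_jk, y j k = Im a_jk.
   The random variables {Re a_jk, Im a_jk}_{j<k} and {a_ii} are indexed by
   (j, k, b), b = false for the real part, b = true for the imaginary part. *)
Definition gue_index n : {set 'I_n * 'I_n * bool} :=
  [set t : 'I_n * 'I_n * bool | (t.1.1 < t.1.2)%N || ((t.1.1 == t.1.2) && ~~ t.2)].

Definition is_GUE n (x y : 'I_n -> 'I_n -> {RV P >-> R}) : Prop :=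
  [/\ (forall j k t, x k j t = x j k t /\ y k j t = - y j k t),
      (forall j t, y j j t = 0),
      (forall j k : 'I_n, (j < k)%N ->
          (has_normal_law (Num.sqrt (2^-1)) (x j k) /\
           has_normal_law (Num.sqrt (2^-1)) (y j k))),
      (forall j, has_normal_law 1 (x j j)) &
      mutually_independent (gue_index n)
        (fun t => if t.2 then (y t.1.1 t.1.2 : T -> R) else x t.1.1 t.1.2)].

Local Open Scope complex_scope.

Definition cexpect (f : T -> R[i]) : R[i] :=
  (Rintegral P setT (fun t => complex.Re (f t)))
    +i* (Rintegral P setT (fun t => complex.Im (f t))).

Definition npow (n : nat) (a : R) : R[i] := ((n%:R : R) `^ a)%:C.

Definition gue_matrix n (x y : 'I_n -> 'I_n -> {RV P >-> R}) (t : T)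
  : 'M[R[i]]_n :=
  \matrix_(j, k) (npow n (-(2^-1)) * ((x j k t) +i* (y j k t))).

Definition resolvent n (x y : 'I_n -> 'I_n -> {RV P >-> R}) (z : R[i]) (t : T) : 'M[R[i]]_n :=
  invmx (gue_matrix x y t - (2 + z * npow n (-(2/3))) %:M).

Definition gfun n (x y : 'I_n -> 'I_n -> {RV P >-> R}) (z : R[i]) (l : nat) (t : T) : R[i] :=
  if l == 1%N then npow n (-(2/3)) * (n%:R + \tr (resolvent x y z t))
  else npow n (-(2 * l%:R / 3)) * \tr (resolvent x y z t ^+ l).

(* multi-index K = [:: k_1; ...; k_j] ; component l (l >= 1) is nth 0 K l.-1 *)
Definition mcomp (K : seq nat) (l : nat) : nat := nth 0%N K l.-1.

Definition madd_e (K : seq nat) (l : nat) : seq nat := incr_nth K l.-1.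
(* K - e_l (l >= 1); only used when the l-th component is positive *)
Definition msub_e (K : seq nat) (l : nat) : seq nat :=
  set_nth 0%N K l.-1 (mcomp K l).-1.

Definition mK n (x y : 'I_n -> 'I_n -> {RV P >-> R}) (z : R[i]) (K : seq nat) : R[i] :=
  cexpect (fun t => \prod_(i < size K) gfun x y z i.+1 t ^+ nth 0%N K i).

End GUE.

(* Main.v *)
(* Gaussian integration by parts gives, for every entry, [E[M_jk F(M)] = E[DF(M)[e_kj]]].
   Applied to [F = G_kj * Phi], with [G] the resolvent at [w = 2 + z n^(-2/3)] and [Phi]
   the product of the [g_l], and summed over [j] and [k], it yields the exact loop equation
     [E[(n + w Tr G) Phi] + n^-1 E[(Tr G)^2 Phi]
        + n^-1 E[\sum_l l k_l n^(-2l/3) Tr G^(l+2) Phi / g_l] = 0],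
   because [Tr (A G) = n + w Tr G] and [D(Tr G^l)[E] = - l Tr (G^(l+1) E)] up to scaling.
   Substituting [Tr G = n^(2/3) g_1 - n] and dividing by [n^(1/3)] gives the recursion with
   all the [O(n^(-2/3))] corrections equal to zero and the factor of [m_(K+e_1)] equal to
   [z n^(-1/3)]. *)
Require Import Defs.
From HB Require Import structures.
From mathcomp Require Import all_boot all_order all_algebra.
From mathcomp Require Import all_classical all_reals all_analysis.
From mathcomp Require Import measurable_realfun.
From mathcomp Require Import complex.
From mathcomp Require Import ring lra zify.
Import Order.TTheory GRing.Theory Num.Theory.
Import numFieldNormedType.Exports.
Local Open Scope ring_scope.
Local Open Scope complex_scope.

(** * Gaussian integration by parts *)

(** Integration by parts is available for one real Gaussian variable at a time, and for bounded
    functions with bounded continuous derivative. Three facts bridge the gap to a complex entry of a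
    Hermitian matrix. Independence lets all the other variables be frozen. The condition
    [complex.Im z != 0] bounds the entries of the resolvent by the inverse of the imaginary part of
    the spectral parameter, uniformly over Hermitian matrices; [n] is fixed, so the bounds may
    depend on it. The matrix unit [e_kj] is not a Hermitian direction, but it is a complex
    combination of two such directions, and the variance 1/2 of each off-diagonal part supplies the
    coefficient. The trace formula for [A G] is the trace of [(A - w) G = 1]. The boundary condition
    is the same equation with [Phi = 1]. *)

Section GaussianIntegration.
Context {R : realType}.
Local Open Scope classical_set_scope.
Local Notation mu := (@lebesgue_measure R).
Implicit Types (s C : R) (f g : R -> R).

(** The Radon-Nikodym derivative in the change of variables agrees almost everywhere with
    [normal_pdf], because both have integral [normal_prob 0 s E] over every measurable [E]. *)
Lemma ge0_integral_normal_prob s (f : R -> \bar R) :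
  measurable_fun setT f -> (forall u, 0 <= f u)%E ->
  (\int[normal_prob 0 s]_u f u = \int[mu]_u (f u * (normal_pdf 0 s u)%:E))%E.
Proof.
move=> mf f0; have dom := normal_prob_dominates 0 s.
rewrite -(Radon_Nikodym_SigmaFinite.change_of_variables dom)//.
apply: ae_eq_integral => //.
- apply: emeasurable_funM => //; apply: (measurable_int mu).
  exact: (Radon_Nikodym_SigmaFinite.f_integrable dom).
- apply: emeasurable_funM => //; apply/measurable_EFinP.
  exact: measurable_normal_pdf.
- apply: ae_eqe_mul2l; apply: integral_ae_eq => //.
  + exact: (Radon_Nikodym_SigmaFinite.f_integrable dom).
  + by apply/measurable_EFinP; exact: measurable_normal_pdf.
  + by move=> E _ mE; rewrite -(Radon_Nikodym_SigmaFinite.f_integral dom).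
Qed.

Lemma integrable_normal_prob s (f : R -> \bar R) : measurable_fun setT f ->
  mu.-integrable setT (fun u => f u * (normal_pdf 0 s u)%:E)%E ->
  (normal_prob 0 s).-integrable setT f.
Proof.
move=> mf /integrableP[_ fi]; apply/integrableP; split => //.
rewrite ge0_integral_normal_prob//; last exact: measurableT_comp.
apply: le_lt_trans fi; rewrite le_eqVlt; apply/orP; left; apply/eqP.
apply: eq_integral => u _.
by rewrite abseM [X in _ = (_ * X)%E]gee0_abs// lee_fin normal_pdf_ge0.
Qed.

Lemma integral_normal_prob s (f : R -> \bar R) : measurable_fun setT f ->
  mu.-integrable setT (fun u => f u * (normal_pdf 0 s u)%:E)%E ->
  (\int[normal_prob 0 s]_u f u = \int[mu]_u (f u * (normal_pdf 0 s u)%:E))%E.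
Proof.
move=> mf fi.
rewrite integralE [RHS]integralE.
rewrite !ge0_integral_normal_prob//; last 2 first.
- exact: measurable_funeneg.
- exact: measurable_funepos.
have p0 u : (0 <= (normal_pdf 0 s u)%:E)%E by rewrite lee_fin normal_pdf_ge0.
congr (_ - _)%E; apply: eq_integral => u _.
- by rewrite !funeposE muleC [in RHS]muleC maxe_pMr// mule0.
- by rewrite !funenegE muleC [in RHS]muleC maxe_pMr// mule0 muleN.
Qed.

Lemma is_derive_normal_pdf s (u : R) : s != 0 ->
  is_derive u (1 : R) (normal_pdf 0 s) (- (u / s ^+ 2) * normal_pdf 0 s u).
Proof.
move=> s0; rewrite normal_pdfE// /normal_fun.
rewrite (_ : (fun x => _) =
    normal_peak s *: (expR \o (fun x => - (x - 0) ^+ 2 / (s ^+ 2 *+ 2)))); last by [].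
apply: is_derive_eq.
rewrite /GRing.scale/= !subr0; set e := expR _; field; exact: s0.
Qed.

(** [expR x >= 1 + x] at [x = u^2 / (2 s^2)]; the resulting quadratic decay kills the boundary terms
    at infinity. *)
Lemma normal_pdf_le s (u : R) : s != 0 ->
  normal_pdf 0 s u * (1 + u ^+ 2 / (s ^+ 2 *+ 2)) <= normal_peak s.
Proof.
move=> s0; rewrite normal_pdfE// /normal_fun -mulrA ler_piMr ?normal_peak_ge0//.
rewrite subr0 mulNr expRN mulrC ler_pdivrMr ?expR_gt0// mul1r.
exact: expR_ge1Dx.
Qed.

(* A Gaussian density times a quadratic is dominated by the density of standard
   deviation [sqrt 2 * s]; this gives integrability of [u * f u] for bounded [f]. *)
Lemma normal_pdf_wide s (u : R) : s != 0 ->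
  normal_pdf 0 s u * (1 + u ^+ 2 / (s ^+ 2 *+ 4)) <=
  Num.sqrt 2 * normal_pdf 0 (Num.sqrt 2 * s) u.
Proof.
move=> s0; have r2 : Num.sqrt (2 : R) != 0 by rewrite gt_eqF ?sqrtr_gt0.
have -> : Num.sqrt 2 * normal_pdf 0 (Num.sqrt 2 * s) u =
    normal_pdf 0 s u * expR (u ^+ 2 / (s ^+ 2 *+ 4)).
  rewrite !normal_pdfE ?mulf_neq0// /normal_fun /normal_peak subr0 -[RHS]mulrA -expRD.
  rewrite [(_ * s) ^+ 2]exprMn sqr_sqrtr//.
  have -> : (2 * s ^+ 2 * pi *+ 2 = 2 * (s ^+ 2 * pi *+ 2))%R by ring.
  rewrite [Num.sqrt (2 * _)]sqrtrM// invfM -mulrA (mulrA (Num.sqrt 2)) mulfV// mul1r.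
  by congr (_ * expR _); field.
by rewrite ler_wpM2l ?normal_pdf_ge0// expR_ge1Dx.
Qed.

(** Since [p' = - (u / s^2) p] for the density [p], the integrand of Stein's identity is an exact
    derivative. *)
Lemma derive_normal_pdf_mul s f g (u : R) : s != 0 ->
  (forall u, is_derive u (1 : R) f (g u)) ->
  is_derive u (1 : R) (fun v => - s ^+ 2 * (f v * normal_pdf 0 s v))
    ((u * f u - s ^+ 2 * g u) * normal_pdf 0 s u).
Proof.
move=> s0 df; have df1 := df u; have dp := is_derive_normal_pdf s u s0.
rewrite (_ : (fun v => _) = - s ^+ 2 *: (f * normal_pdf 0 s)); last by [].
apply: is_derive_eq.
rewrite /GRing.scale/=; field; exact: s0.
Qed.

(** Formulated along a sequence so as to cover both end points [k.+1] and [- k.+1] of growing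
    intervals. *)
Lemma cvg_normal_pdf s (a : R^nat) : s != 0 ->
  (forall k, k.+1%:R <= `|a k|) -> normal_pdf 0 s (a k) @[k --> \oo] --> 0.
Proof.
move=> s0 ak.
have ss0 : 0 < s ^+ 2 *+ 2 by rewrite pmulrn_lgt0// exprn_even_gt0.
apply: (@squeeze_cvgr _ _ _ _ (cst 0)
  (fun k => normal_peak s * (s ^+ 2 *+ 2) * harmonic k)).
- apply: nearW => k; rewrite normal_pdf_ge0/= /harmonic ler_pdivlMr ?ltr0n//.
  have := normal_pdf_le s (a k) s0.
  move/(ler_wpM2r (ltW ss0)); apply: le_trans.
  rewrite -mulrA ler_wpM2l ?normal_pdf_ge0// mulrDl divfK ?gt_eqF// mul1r.
  have -> : a k ^+ 2 = `|a k| ^+ 2 by rewrite real_normK// num_real.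
  apply: (@le_trans _ _ (k.+1%:R ^+ 2)); last first.
    by rewrite ler_wpDl ?(ltW ss0)// lerXn2r// nnegrE.
  by rewrite expr2 ler_peMl// ler1n.
- exact: cvg_cst.
- rewrite -[X in _ --> X](mulr0 (normal_peak s * (s ^+ 2 *+ 2))).
  by apply: cvgMl_tmp; exact: cvg_harmonic.
Qed.

Lemma integrable_stein s C f g : s != 0 ->
  measurable_fun setT f -> measurable_fun setT g ->
  (forall u, `|f u| <= C) -> (forall u, `|g u| <= C) ->
  mu.-integrable setT (fun u => ((u * f u - s ^+ 2 * g u) * normal_pdf 0 s u)%:E).
Proof.
(* The factor [Num.sqrt 2] comes from [normal_pdf_wide]; [1 + 5 s^2] is a convenient, not optimal,
   constant with [|u| + s^2 <= (1 + 5 s^2) (1 + u^2 / (4 s^2))]. *)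
move=> s0 mf mg fC gC; set K := C * (1 + 5 * s ^+ 2) * Num.sqrt 2.
have s4 : 0 < s ^+ 2 by rewrite exprn_even_gt0.
have C0 : 0 <= C by rewrite (le_trans _ (fC 0)).
have mh : measurable_fun setT (fun u : R => (u * f u - s ^+ 2 * g u) * normal_pdf 0 s u).
  apply: measurable_funM; last exact: measurable_normal_pdf.
  by apply: measurable_funB; apply: measurable_funM.
apply: (@le_integrable _ _ _ mu setT _ _
  (fun u => K%:E * (normal_pdf 0 (Num.sqrt 2 * s) u)%:E)%E) => //.
- exact/measurable_EFinP.
- move=> u _; rewrite -EFinM !abse_EFin lee_fin.
  rewrite (normrM (u * f u - _)) (ger0_norm (normal_pdf_ge0 0 s u)).
  rewrite (@ger0_norm _ (K * _)); last first.
    by rewrite !mulr_ge0 ?sqrtr_ge0 ?normal_pdf_ge0// addr_ge0// mulr_ge0// ltW.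
  apply: (@le_trans _ _ (C * (1 + 5 * s ^+ 2) *
      (normal_pdf 0 s u * (1 + u ^+ 2 / (s ^+ 2 *+ 4))))); last first.
    rewrite /K -(mulrA (C * _)) ler_wpM2l ?normal_pdf_wide//.
    by rewrite mulr_ge0// addr_ge0// mulr_ge0// ltW.
  rewrite [X in _ <= X]mulrCA [X in X <= _]mulrC ler_wpM2l ?normal_pdf_ge0//.
  rewrite (le_trans (ler_normB _ _))// (normrM u) (normrM (s ^+ 2)) (ger0_norm (ltW s4)).
  apply: (@le_trans _ _ (C * (`|u| + s ^+ 2))).
    rewrite mulrDr lerD//; first by rewrite mulrC ler_wpM2r.
    by rewrite mulrC ler_wpM2r// ltW.
  rewrite -(mulrA C) ler_wpM2l//.
  have -> : (1 + 5 * s ^+ 2) * (1 + u ^+ 2 / (s ^+ 2 *+ 4)) =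
    1 + 5 * s ^+ 2 + (u ^+ 2 / (s ^+ 2 *+ 4)) + 5/4 * u ^+ 2 by field; exact: s0.
  have : 0 <= u ^+ 2 / (s ^+ 2 *+ 4) by rewrite divr_ge0 ?sqr_ge0// mulrn_wge0 ?ltW.
  have : u ^+ 2 = `|u| ^+ 2 by rewrite real_normK// num_real.
  by move=> ->; nra.
- by apply: integrableZl => //; exact: integrable_normal_pdf.
Qed.

(** The integral over [[-k-1, k+1]] is a difference of boundary values of [- s^2 f p], which tend to
    0 because [f] is bounded; dominated convergence, with the integrable [|h|] as bound, reaches the
    whole line. *)
Lemma integral_stein s C f g : s != 0 ->
  (forall u, is_derive u (1 : R) f (g u)) -> continuous g ->
  (forall u, `|f u| <= C) -> (forall u, `|g u| <= C) ->
  (\int[mu]_u ((u * f u - s ^+ 2 * g u) * normal_pdf 0 s u)%:E = 0)%E.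
Proof.
move=> s0 df cg fC gC.
have cf : continuous f.
  move=> u; apply: differentiable_continuous; apply/derivable1_diffP.
  exact: (@ex_derive _ _ _ _ _ _ _ (df u)).
set h := fun u => (u * f u - s ^+ 2 * g u) * normal_pdf 0 s u.
pose F v := - s ^+ 2 * (f v * normal_pdf 0 s v).
have dF u : is_derive u (1 : R) F (h u) by exact: derive_normal_pdf_mul.
have cF : continuous F.
  move=> u; apply: differentiable_continuous; apply/derivable1_diffP.
  exact: (@ex_derive _ _ _ _ _ _ _ (dF u)).
have ch : continuous h.
  move=> u; apply: (@cvgM _ _ _ _ (fun u => u * f u - s ^+ 2 * g u) (normal_pdf 0 s));
    last exact: continuous_normal_pdf.
  apply: (@cvgB _ R^o); first by apply: cvgM; [exact: cvg_id|exact: cf].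
  by apply: cvgM; [exact: cvg_cst|exact: cg].
have mf := continuous_measurable_fun cf; have mg := continuous_measurable_fun cg.
have mh := continuous_measurable_fun ch.
have ih := integrable_stein s C f g s0 mf mg fC gC.
pose I (k : nat) := `[- k.+1%:R, k.+1%:R : R]%classic.
have Ih k : (\int[mu]_(u in I k) (h u)%:E = (F k.+1%:R - F (- k.+1%:R))%:E)%E.
  rewrite (@continuous_FTC2 _ h F) ?EFinB//.
  - by rewrite gtrN.
  - exact: continuous_subspaceT.
  - split.
    + by move=> u _; exact: (@ex_derive _ _ _ _ _ _ _ (dF u)).
    + by apply: cvg_at_right_filter; exact: cF.
    + by apply: cvg_at_left_filter; exact: cF.
  - by move=> u _; rewrite derive1E; exact: (@derive_val _ _ _ _ _ _ _ (dF u)).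
have F0 : (F k.+1%:R - F (- k.+1%:R))%:E @[k --> \oo] --> 0%E.
  apply: cvg_EFin; first exact: nearW.
  have bF (a : R^nat) : (forall k, k.+1%:R <= `|a k|) -> F (a k) @[k --> \oo] --> 0.
    move=> ak; rewrite -[X in _ --> X](mulr0 (- s ^+ 2)); apply: cvgMl_tmp.
    apply/norm_cvg0P; apply: (@squeeze_cvgr _ _ _ _ (cst 0)
      (fun k => C * normal_pdf 0 s (a k))).
    - apply: nearW => k; rewrite normr_ge0/= normrM.
      by rewrite (ger0_norm (normal_pdf_ge0 0 s _)) ler_wpM2r ?normal_pdf_ge0.
    - exact: cvg_cst.
    - by rewrite -[X in _ --> X](mulr0 C); apply: cvgMl_tmp; exact: cvg_normal_pdf.
  rewrite -[X in _ --> X](subr0 0); apply: (@cvgB _ R^o).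
    by apply: bF => k; rewrite ger0_norm.
  by apply: bF => k; rewrite normrN ger0_norm.
have [|||||_ _] := @dominated_convergence _ _ _ mu setT measurableT
  (fun k => (EFin \o h) \_ (I k)) (EFin \o h) (fun u => `|(h u)%:E|%E).
- move=> k; apply/(measurable_restrictT _ _).1 => //; first exact: measurable_itv.
  by apply/measurable_EFinP; apply: measurable_funTS.
- exact/measurable_EFinP.
- apply: aeW => u _; apply: cvg_near_cst.
  have /cvgryPge/(_ `|u|)[N _ hN] := @cvgr_idn R.
  exists N => // k /= Nk; rewrite patchE mem_set// /I/= in_itv/= -ler_norml.
  by rewrite (le_trans (hN _ Nk))// ler_nat.
- by have /integrable_abse := ih.
- apply: aeW => u k _; rewrite patchE; case: ifPn => //= _.
  by rewrite normr0 lee_fin.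
rewrite (_ : (fun k => _) = fun k => (F k.+1%:R - F (- k.+1%:R))%:E); last first.
  by apply/funext => k; rewrite -Ih [RHS]integral_mkcond.
by move/cvg_unique => /(_ _ _ F0) ->.
Qed.

End GaussianIntegration.

(** * Independence: one variable against all the others *)

Section Independence.
Context {R : realType} {d : measure_display} {T : measurableType d}
  (P : probability T R) (I : finType) (S : {set I}) (X : I -> T -> R) (i : I).
Local Open Scope classical_set_scope.
Hypothesis mX : forall j, measurable_fun setT (X j).
Hypothesis iS : i \in S.
(** Independence says nothing outside [S]; constant variables there keep every [X j] with [j != i]
    measurable for the sigma-algebra below. *)
Hypothesis X0 : forall j, j \notin S -> X j = cst 0.
Hypothesis indX : mutually_independent P S X.

(* The sigma-algebra on [T] generated by all the variables but [X i]: working with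
   the pair [(X i, id)] on [R * T'] replaces the construction of the joint law of
   the remaining variables on a finite product space. *)
Definition boxes : set (set T) := [set A | exists B : I -> set R,
  (forall j, measurable (B j)) /\
    A = [set t | forall j, j \in (S :\ i)%SET -> B j (X j t)]].

(* [normal_prob] is a measure on [measurableTypeR R], whose display is not
   convertible to the default one of [R]. *)
Local Notation R' := (measurableTypeR R).
Local Notation T' := (g_sigma_algebraType boxes).

Lemma measurable_box (J : {set I}) (B : I -> set R) :
  (forall j, measurable (B j)) ->
  measurable [set t | forall j, j \in J -> B j (X j t)].
Proof.
move=> mB; rewrite (_ : [set t | _] = \bigcap_(j in [set` J]) (X j @^-1` B j)); last first.
  by apply/seteqP; split => t /= h j; [move=> /h|move=> /(h j)].
apply: fin_bigcap_measurable; first exact: finite_finset.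
by move=> j _; rewrite -[X in measurable X]setTI; exact: mX.
Qed.

Lemma sub_boxes (A : set T) : <<s boxes >> A -> measurable A.
Proof.
apply: smallest_sub; first exact: sigma_algebra_measurable.
by move=> _ [B [mB ->]]; exact: measurable_box.
Qed.

Lemma measurable_forget : measurable_fun setT (idfun : T -> T').
Proof. by move=> _ A mA; rewrite setTI; exact: sub_boxes. Qed.

Lemma measurable_forgetful j : j != i ->
  measurable_fun [set: T'] (X j : T' -> R).
Proof.
move=> ji; have [jS|/X0 ->] := boolP (j \in S); last exact: measurable_cst.
move=> _ B mB; rewrite setTI; apply: sub_sigma_algebra.
exists (fun k => if k == j then B else setT); split.
  by move=> k; case: ifP.
apply/seteqP; split => t /=; first by move=> Bt k _; case: eqP => // ->.
by move/(_ j); rewrite eqxx !inE ji; exact.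
Qed.

Lemma boxes_setI : setI_closed boxes.
Proof.
move=> _ _ [B1 [mB1 ->]] [B2 [mB2 ->]]; exists (fun j => B1 j `&` B2 j); split.
  by move=> j; exact: measurableI.
apply/seteqP; split => t /=; first by move=> [h1 h2] j jS; split; [exact: h1|exact: h2].
by move=> h; split => j /h[].
Qed.

Lemma boxes_setT : boxes setT.
Proof. by exists (fun=> setT); split => //; apply/seteqP; split. Qed.

(** Mutual independence is used twice, with [A] and with [setT] as the set for [X i]; the second use
    identifies the product over the other variables with [P C]. *)
Lemma independent_boxes (A : set R) (C : set T) : measurable A -> boxes C ->
  P (X i @^-1` A `&` C) = (P (X i @^-1` A) * P C)%E.
Proof.
move=> mA [B [mB ->]].
have h (D : set R) : measurable D ->
    P (X i @^-1` D `&` [set t | forall j, j \in (S :\ i)%SET -> B j (X j t)]) =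
    (P (X i @^-1` D) * \prod_(j in (S :\ i)%SET) P (X j @^-1` B j))%E.
  move=> mD; have := indX S (fun j => if j == i then D else B j) (subxx _).
  rewrite (_ : [set t | _] = X i @^-1` D `&`
      [set t | forall j, j \in (S :\ i)%SET -> B j (X j t)]); last first.
    apply/seteqP; split => t /=.
      move=> h; split; first by have := h i iS; rewrite eqxx.
      by move=> j /setD1P[/negPf ji jS]; have := h j jS; rewrite ji.
    move=> [h1 h2] j jS; case: eqP => [->//|/eqP ji].
    by apply: h2; rewrite !inE ji.
  move=> ->; last by move=> j; case: ifP.
  rewrite (bigD1 i)//= eqxx; congr (_ * _)%E.
  apply: eq_big => [j|j /andP[_ /negPf ->]//]; by rewrite !inE andbC.
rewrite h//; congr (_ * _)%E.
have := h setT measurableT; rewrite preimage_setT setTI probability_setT mul1e.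
by move=> ->.
Qed.

(** Both sides are finite measures in [C] that agree on [boxes], a pi-system containing [setT].
    Pushing forward along [idfun : T -> T'] restricts a measure to the smaller sigma-algebra. *)
Lemma independent_sigma (A : set R) (C : set T) : measurable A -> <<s boxes >> C ->
  P (X i @^-1` A `&` C) = (P (X i @^-1` A) * P C)%E.
Proof.
move=> mA; have mXA : measurable (X i @^-1` A).
  by rewrite -[X in measurable X]setTI; exact: mX.
have finA : P (X i @^-1` A) \is a fin_num by rewrite fin_num_measure.
move=> sC; pose a := NngNum (fine_ge0 (measure_ge0 P (X i @^-1` A))).
pose m1 := mrestr P mXA; pose m2 := mscale a P.
have := @measure_unique _ R T' boxes (fun=> setT) erefl boxes_setI (fun=> boxes_setT) _
  (pushforward m1 (idfun : T -> T')) (pushforward m2 (idfun : T -> T')) _ _ C sC.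
rewrite /m1 /m2 /pushforward/= /mrestr /mscale/= fineK// setIC; apply.
- by rewrite bigcup_const.
- exact: measurable_forget.
- exact: measurable_forget.
- by move=> B /(independent_boxes A B mA); rewrite setIC.
- move=> _; rewrite /pushforward preimage_setT setTI.
  by rewrite (le_lt_trans (probability_le1 _ _)) ?ltry.
Qed.

(** Its law is [P] restricted to the sigma-algebra generated by [boxes], standing in for the joint
    law of the other variables. *)
Definition forget_RV : {RV P >-> T'} :=
  MeasurableFun.Pack (MeasurableFun.Class
    (isMeasurableFun.Build _ _ _ _ (idfun : T -> T') measurable_forget)).

Lemma measurable_pair_forget : measurable_fun setT (fun t => (X i t, t) : R' * T').
Proof. by apply/measurable_fun_pairP; split; [exact: mX|exact: measurable_forget]. Qed.

Definition pair_forget_RV : {RV P >-> (R' * T')%type} :=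
  MeasurableFun.Pack (MeasurableFun.Class
    (isMeasurableFun.Build _ _ _ _ (fun t => (X i t, t) : R' * T') measurable_pair_forget)).

Lemma law_product (m : {sigma_finite_measure set R' -> \bar R}) :
  (forall A : set R', measurable A -> P (X i @^-1` A) = m A) ->
  forall E : set (R' * T'), measurable E ->
  (m \x distribution P forget_RV)%E E = distribution P pair_forget_RV E.
Proof.
move=> mP E mE; apply: product_measure_unique => // A B mA mB.
by rewrite -mP//= -independent_sigma.
Qed.

(** Fubini. The sample point [t] is the second coordinate, but measurability of [h] on [R' * T']
    lets it see only the variables other than [X i]. Integrability along [(X i t, t)] is
    integrability for the product law, by [law_product]. *)
Lemma integral_law_product_eq0 (m : {sigma_finite_measure set R' -> \bar R})
    (h : R' * T' -> \bar R) :
  (forall A : set R', measurable A -> P (X i @^-1` A) = m A) ->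
  measurable_fun setT h -> P.-integrable setT (fun t => h (X i t, t)) ->
  (forall t, \int[m]_u h (u, t) = 0)%E ->
  (\int[P]_t h (X i t, t) = 0)%E.
Proof.
move=> mP mh ih h0.
have mah : measurable_fun setT (fun z => `|h z|)%E by exact: measurableT_comp.
have prodE (k : R' * T' -> \bar R) :
    (\int[m \x distribution P forget_RV]_z k z =
     \int[distribution P pair_forget_RV]_z k z)%E.
  by apply: eq_measure_integral => E mE _; exact: law_product.
have iprod : (m \x distribution P forget_RV)%E.-integrable setT h.
  apply/integrableP; split => //; rewrite prodE ge0_integral_distribution//.
  by move/integrableP : ih => [].
transitivity (\int[distribution P pair_forget_RV]_z h z)%E.
  by rewrite integral_distribution.
rewrite -prodE -integral21_prod_meas1//.
by apply: integral0_eq => t _; exact: h0.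
Qed.
End Independence.

Definition upd (I : eqType) (V : Type) (i : I) (v : V) (c : I -> V) : I -> V :=
  fun j => if j == i then v else c j.

Arguments upd {I V}.

(** Tested on arbitrary measurable families instead of through a sigma-algebra on [I -> R]; it is
    applied both to the variables on [T] and to their updates on [R' * T']. *)
Definition measurable_functional (R : realType) (I : Type) (phi : (I -> R) -> R) :=
  forall d (T : measurableType d) (Y : I -> T -> R),
    (forall j, measurable_fun setT (Y j)) ->
    measurable_fun setT (fun t => phi (Y ^~ t)).
Arguments measurable_functional {R I}.

Section GaussianIBP.
Context {R : realType} {d : measure_display} {T : measurableType d}
  (P : probability T R) (I : finType) (S : {set I}) (X : I -> T -> R) (i : I).
Local Open Scope classical_set_scope.
Local Notation mu := (@lebesgue_measure R).
Hypothesis mX : forall j, measurable_fun setT (X j).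
Hypothesis iS : i \in S.
Hypothesis X0 : forall j, j \notin S -> X j = cst 0.
Hypothesis indX : mutually_independent P S X.
Variable s : R.
Hypothesis s0 : s != 0.
Hypothesis lawX : forall A, measurable A -> P (X i @^-1` A) = normal_prob 0 s A.

Local Notation R' := (measurableTypeR R).
Let RVX : {RV P >-> R'} :=
  MeasurableFun.Pack (MeasurableFun.Class (isMeasurableFun.Build _ _ _ R' (X i) (mX i))).

Lemma integrable_gaussian : P.-integrable setT (fun t => (X i t)%:E).
Proof.
have mid : measurable_fun setT (fun u : R' => u%:E) by exact/measurable_EFinP.
have iN : (normal_prob 0 s).-integrable setT (fun u : R' => u%:E).
  apply: integrable_normal_prob => //.
  (* The case [f = 1], [g = 0] of [integrable_stein], where the integrand is [u] times the
     density. *)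
  have h : mu.-integrable setT (fun u => ((u * cst 1 u - s ^+ 2 * cst 0 u) * normal_pdf 0
    s u)%:E).
    by apply: (@integrable_stein R s 1) => // u; rewrite ?normr1 ?normr0.
  apply: eq_integrable h => // u _.
  by rewrite /= mulr1 mulr0 subr0 EFinM.
apply/integrableP; split; first by apply/measurable_EFinP; exact: mX.
have -> : (\int[P]_t `|(X i t)%:E| = \int[distribution P RVX]_u `|u%:E|)%E.
  by rewrite ge0_integral_distribution//; exact: measurableT_comp.
have -> : (\int[distribution P RVX]_u `|u%:E| = \int[normal_prob 0 s]_u `|u%:E|)%E.
  by apply: eq_measure_integral => A mA _; exact: lawX.
by have /integrableP[] := iN.
Qed.

Variables (phi psi : (I -> R) -> R) (C : R).
Hypothesis mphi : measurable_functional phi.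
Hypothesis mpsi : measurable_functional psi.
Hypothesis phiC : forall c, `|phi c| <= C.
Hypothesis psiC : forall c, `|psi c| <= C.
Hypothesis dphi : forall c u,
  is_derive u (1 : R) (fun v => phi (upd i v c)) (psi (upd i u c)).
Hypothesis cpsi : forall c, continuous (fun u => psi (upd i u c)).

Lemma updX t : upd i (X i t) (X ^~ t) = X ^~ t.
Proof. by apply/funext => j; rewrite /upd; case: eqP => // ->. Qed.

Lemma integrable_functional (chi : (I -> R) -> R) : measurable_functional chi ->
  (forall c, `|chi c| <= C) -> P.-integrable setT (fun t => (chi (X ^~ t))%:E).
Proof.
move=> mchi chiC.
apply: (@le_integrable _ _ _ P setT _ _ (fun=> C%:E)) => //.
- by apply/measurable_EFinP; exact: mchi.
- by move=> t _; rewrite !abse_EFin lee_fin (le_trans (chiC _))// ler_norm.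
- by apply: finite_measure_integrable_cst.
Qed.

Lemma integrable_gaussianM : P.-integrable setT (fun t => (X i t * phi (X ^~ t))%:E).
Proof.
apply: (@le_integrable _ _ _ P setT _ _ (fun t => C%:E * (X i t)%:E)%E) => //.
- by apply/measurable_EFinP; apply: measurable_funM; [exact: mX|exact: mphi].
- move=> t _; rewrite -EFinM !abse_EFin lee_fin !normrM mulrC ler_wpM2r//.
  by rewrite (le_trans (phiC _))// ler_norm.
- by apply: integrableZl => //; exact: integrable_gaussian.
Qed.

(** With coordinate [i] replaced by a free variable [u], the difference of the two integrands has
    zero Gaussian integral in [u] for each frozen [t], by [integral_stein]; [u = X i t] gives back
    the original integrands. *)
Lemma gaussian_ibp :
  Rintegral P setT (fun t => X i t * phi (X ^~ t)) =
  s ^+ 2 * Rintegral P setT (fun t => psi (X ^~ t)).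
Proof.
have ipsi := integrable_functional _ mpsi psiC.
have ipsi2 : P.-integrable setT (fun t => (s ^+ 2 * psi (X ^~ t))%:E).
  by apply: eq_integrable (integrableZl measurableT (s ^+ 2) ipsi).
apply/eqP; rewrite -subr_eq0 -RintegralZl// -RintegralB//; last exact: integrable_gaussianM.
pose T' := g_sigma_algebraType (boxes I S X i).
pose h (z : R' * T') := ((z.1 * phi (upd i z.1 (X ^~ z.2)) -
   s ^+ 2 * psi (upd i z.1 (X ^~ z.2)))%:E).
have mupd j : measurable_fun setT (fun z : R' * T' => upd i z.1 (X ^~ z.2) j).
  rewrite /upd; case: eqP => [_|/eqP ji]; first exact: measurable_fst.
  have mj := measurable_forgetful I S X i X0 j ji.
  exact: (measurableT_comp mj measurable_snd).
have mh : measurable_fun setT h.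
  apply/measurable_EFinP; apply: measurable_funB; apply: measurable_funM => //.
  - exact: mphi mupd.
  - exact: mpsi mupd.
have hE t : h (X i t, t) = (X i t * phi (X ^~ t) - s ^+ 2 * psi (X ^~ t))%:E.
  by rewrite /h /= updX.
have ih : P.-integrable setT (fun t => h (X i t, t)).
  apply: (eq_integrable measurableT _ _ _ (integrableB measurableT integrable_gaussianM
    ipsi2)).
  by move=> t _; rewrite hE.
have h0 t : (\int[normal_prob 0 s]_u h (u, t) = 0)%E.
  pose f u := phi (upd i u (X ^~ t)); pose g u := psi (upd i u (X ^~ t)).
  have cf : continuous f.
    move=> u; apply: differentiable_continuous; apply/derivable1_diffP.
    exact: (@ex_derive _ _ _ _ _ _ _ (dphi (X ^~ t) u)).
  have mf := continuous_measurable_fun cf.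
  have mg := continuous_measurable_fun (cpsi (X ^~ t)).
  rewrite integral_normal_prob.
  - exact: (@integral_stein R s C f g s0 (dphi _) (cpsi _) (fun u => phiC _) (fun u =>
    psiC _)).
  - apply/measurable_EFinP; apply: measurable_funB; apply: measurable_funM => //;
    exact: measurable_id.
  - exact: (integrable_stein s C f g s0 mf mg (fun u => phiC _) (fun u => psiC _)).
have E0 := @integral_law_product_eq0 R d T P I S X i mX iS indX (normal_prob 0 s) h lawX
  mh ih h0.
rewrite /Rintegral (_ : integral _ _ _ = 0%E)// -[RHS]E0.
by apply: eq_integral => t _; rewrite hE.
Qed.
End GaussianIBP.

(** * Smooth functionals of Hermitian matrices and the resolvent *)

Section ComplexNorm.
Context {R : realType}.
Implicit Types (a b z w : R[i]).
Local Notation nc := Normc.normc.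

Lemma ReD a b : complex.Re (a + b) = complex.Re a + complex.Re b.
Proof. by case: a; case: b. Qed.
Lemma ImD a b : complex.Im (a + b) = complex.Im a + complex.Im b.
Proof. by case: a; case: b. Qed.
Lemma ReN a : complex.Re (- a) = - complex.Re a. Proof. by case: a. Qed.
Lemma ImN a : complex.Im (- a) = - complex.Im a. Proof. by case: a. Qed.
Lemma ReM a b :
  complex.Re (a * b) = complex.Re a * complex.Re b - complex.Im a * complex.Im b.
Proof. by case: a; case: b. Qed.
Lemma ImM a b :
  complex.Im (a * b) = complex.Re a * complex.Im b + complex.Im a * complex.Re b.
Proof. by case: a; case: b. Qed.
Lemma complexP a b : complex.Re a = complex.Re b -> complex.Im a = complex.Im b -> a = b.
Proof. by case: a => ? ?; case: b => ? ? /= -> ->. Qed.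

Lemma normc_ge0 a : 0 <= nc a. Proof. by case: a => x y; exact: sqrtr_ge0. Qed.
Lemma normcD a b : nc (a + b) <= nc a + nc b. Proof. exact: le_normcD. Qed.
Lemma normcB a b : nc (a - b) <= nc a + nc b.
Proof. by rewrite (le_trans (normcD _ _))// normcN. Qed.
Lemma normcR (r : R) : nc r%:C = `|r|.
Proof. by rewrite /Normc.normc /= expr0n/= addr0 sqrtr_sqr. Qed.
Lemma Re_le_normc a : `|complex.Re a| <= nc a.
Proof. by case: a => x y /=; rewrite -sqrtr_sqr ler_wsqrtr// lerDl sqr_ge0. Qed.
Lemma Im_le_normc a : `|complex.Im a| <= nc a.
Proof. by case: a => x y /=; rewrite -sqrtr_sqr ler_wsqrtr// lerDr sqr_ge0. Qed.
Lemma sqr_normcE a : (nc a ^+ 2)%:C = a * a^*.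
Proof.
case: a => x y; rewrite /Normc.normc sqr_sqrtr ?addr_ge0 ?sqr_ge0//.
by apply: complexP => /=; ring.
Qed.

End ComplexNorm.

Section ComplexMeasurable.
Context {R : realType} {d : measure_display} {T : measurableType d}.
Implicit Types (f g : T -> R[i]).
Local Open Scope classical_set_scope.

Definition cmeasurable f :=
  measurable_fun setT (fun t => complex.Re (f t)) /\
  measurable_fun setT (fun t => complex.Im (f t)).

Lemma cmeasurable_cst (c : R[i]) : cmeasurable (fun=> c).
Proof. by split; exact: measurable_cst. Qed.

Lemma cmeasurableD f g : cmeasurable f -> cmeasurable g -> cmeasurable (fun t => f t + g t).
Proof.
move=> [f1 f2] [g1 g2]; split.
- by under eq_fun do rewrite ReD; exact: measurable_funD.
- by under eq_fun do rewrite ImD; exact: measurable_funD.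
Qed.

Lemma cmeasurableM f g : cmeasurable f -> cmeasurable g -> cmeasurable (fun t => f t * g t).
Proof.
move=> [f1 f2] [g1 g2]; split.
- by under eq_fun do rewrite ReM; apply: measurable_funB; exact: measurable_funM.
- by under eq_fun do rewrite ImM; apply: measurable_funD; exact: measurable_funM.
Qed.

Lemma cmeasurable_sum (I : Type) (r : seq I) (Q : pred I) (F : I -> T -> R[i]) :
  (forall i, cmeasurable (F i)) -> cmeasurable (fun t => \sum_(i <- r | Q i) F i t).
Proof.
move=> mF; elim: r => [|i r IH].
  by under eq_fun do rewrite big_nil; exact: cmeasurable_cst.
under eq_fun do rewrite big_cons; case: (Q i) => //; exact: cmeasurableD.
Qed.

Lemma cmeasurable_prod (I : Type) (r : seq I) (Q : pred I) (F : I -> T -> R[i]) :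
  (forall i, cmeasurable (F i)) -> cmeasurable (fun t => \prod_(i <- r | Q i) F i t).
Proof.
move=> mF; elim: r => [|i r IH].
  by under eq_fun do rewrite big_nil; exact: cmeasurable_cst.
under eq_fun do rewrite big_cons; case: (Q i) => //; exact: cmeasurableM.
Qed.

Lemma measurable_invr (f : T -> R) : (forall t, 0 <= f t) ->
  measurable_fun setT f -> measurable_fun setT (fun t => (f t)^-1).
Proof.
move=> f0 mf; under eq_fun do rewrite -powR_inv1//.
exact: (measurableT_comp (measurable_powR _) mf).
Qed.

Lemma cmeasurableV f : cmeasurable f -> cmeasurable (fun t => (f t)^-1).
Proof.
move=> [f1 f2]; pose q t := (complex.Re (f t) ^+ 2 + complex.Im (f t) ^+ 2)^-1.
have mq : measurable_fun setT q.
  apply: measurable_invr; first by move=> t; rewrite addr_ge0 ?sqr_ge0.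
  by apply: measurable_funD; exact: measurable_funX.
have Vf t : (f t)^-1 = (complex.Re (f t) * q t) +i* (- (complex.Im (f t) * q t)).
  by rewrite /q; case: (f t).
split; under eq_fun do rewrite Vf /=; first exact: measurable_funM.
by apply: measurable_funN; exact: measurable_funM.
Qed.

Lemma cmeasurable_det n (M : T -> 'M[R[i]]_n) :
  (forall j k, cmeasurable (fun t => M t j k)) -> cmeasurable (fun t => \det (M t)).
Proof.
move=> mM; apply: cmeasurable_sum => s; apply: cmeasurableM; first exact: cmeasurable_cst.
exact: cmeasurable_prod.
Qed.

Lemma cmeasurable_invmx n (M : T -> 'M[R[i]]_n) :
  (forall t, M t \in unitmx) -> (forall j k, cmeasurable (fun t => M t j k)) ->
  forall j k, cmeasurable (fun t => invmx (M t) j k).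
Proof.
move=> uM mM j k; under eq_fun do rewrite /invmx uM !mxE.
apply: cmeasurableM; first by apply: cmeasurableV; exact: cmeasurable_det.
apply: cmeasurableM; first exact: cmeasurable_cst.
by apply: cmeasurable_det => a b; under eq_fun do rewrite !mxE; exact: mM.
Qed.
End ComplexMeasurable.

Section Resolvent.
Context {R : realType}.
Local Notation nc := Normc.normc.
Implicit Types (w : R[i]).

Definition dagger m n (M : 'M[R[i]]_(m, n)) : 'M[R[i]]_(n, m) := (map_mx (@conjc R) M)^T.
Arguments dagger {m n}.

Lemma daggerM m n p (A : 'M[R[i]]_(m, n)) (B : 'M[R[i]]_(n, p)) :
  dagger (A *m B) = dagger B *m dagger A.
Proof. by rewrite /dagger map_mxM trmx_mul. Qed.

Lemma daggerK m n (A : 'M[R[i]]_(m, n)) : dagger (dagger A) = A.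
Proof. by apply/matrixP => i j; rewrite !mxE conjcK. Qed.

Lemma daggerB m n (A B : 'M[R[i]]_(m, n)) : dagger (A - B) = dagger A - dagger B.
Proof. by apply/matrixP => i j; rewrite !mxE rmorphB. Qed.

Lemma daggerZ m n a (A : 'M[R[i]]_(m, n)) : dagger (a *: A) = conjc a *: dagger A.
Proof. by apply/matrixP => i j; rewrite !mxE rmorphM. Qed.

Lemma dagger_scalar n a : dagger (a%:M : 'M[R[i]]_n) = (conjc a)%:M.
Proof.
by apply/matrixP => i j; rewrite !mxE eq_sym; case: eqP;
  rewrite ?mulr1n ?mulr0n ?rmorph0. Qed.

Definition selfadj n (M : 'M[R[i]]_n) := dagger M = M.
Arguments selfadj {n}.

Lemma selfadjD n (A B : 'M[R[i]]_n) : selfadj A -> selfadj B -> selfadj (A + B).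
Proof.
by rewrite /selfadj => hA hB; rewrite -[B]opprK daggerB -{2}hA; congr (_ - _);
  apply/matrixP => i j; rewrite -{2}hB !mxE rmorphN. Qed.

Lemma selfadjZ n (r : R) (A : 'M[R[i]]_n) : selfadj A -> selfadj (r%:C *: A).
Proof. by rewrite /selfadj daggerZ conjc_real => ->. Qed.

Lemma Im_conj_neq w : complex.Im w != 0 -> w - w^* != 0.
Proof.
rewrite subcJ => w0; rewrite !mulf_neq0 ?pnatr_eq0//.
- by apply: contra w0 => /eqP[->].
- by apply/eqP => -[] /eqP; rewrite oner_eq0.
Qed.

Lemma mulmx_dagger_diag m n (A : 'M[R[i]]_(m, n)) a :
  (A *m dagger A) a a = (\sum_b nc (A a b) ^+ 2)%:C.
Proof. by rewrite mxE rmorph_sum /=; apply: eq_bigr => b _; rewrite !mxE sqr_normcE. Qed.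

(** A Hermitian matrix has no non-real eigenvalue: if [v H = w v], then [v H v^dagger] is its own
    conjugate, so [(w - conj w) |v|^2 = 0]. *)
Lemma resolvent_unit n (H : 'M[R[i]]_n) w : selfadj H -> complex.Im w != 0 ->
  H - w%:M \in unitmx.
Proof.
move=> hH w0; rewrite unitmxE unitfE; apply/det0P => -[v v0].
rewrite mulmxBr => /eqP; rewrite subr_eq0 mul_mx_scalar => /eqP vH.
have : v *m H *m dagger v = dagger (v *m H *m dagger v).
  by rewrite !daggerM daggerK hH mulmxA.
rewrite vH -scalemxAl daggerZ daggerM daggerK => /eqP.
rewrite -subr_eq0 -scalerBl scaler_eq0 (negPf (Im_conj_neq _ w0))/= => /eqP/matrixP/(_ 0 0).
rewrite mulmx_dagger_diag mxE => /complexI/eqP.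
rewrite psumr_eq0 => [/allP s0|b _]; last by rewrite sqr_ge0.
case/eqP: v0; apply/rowP => b; rewrite mxE.
have := s0 b (mem_index_enum b); rewrite sqrf_eq0 => /eqP; exact: Normc.eq0_normc.
Qed.

(* With [G] the resolvent, [G - G^dagger = (w - conj w) G G^dagger]; its diagonal gives
   [Im (G a a) = Im w * \sum_b |G a b|^2]. *)
Lemma resolvent_entry n (H : 'M[R[i]]_n) w a b : selfadj H -> complex.Im w != 0 ->
  nc (invmx (H - w%:M) a b) <= `|complex.Im w|^-1.
Proof.
move=> hH w0; set A := H - w%:M; set G := invmx A.
have uA : A \in unitmx by exact: resolvent_unit.
have GE : G - dagger G = (w - w^*) *: (G *m dagger G).
  have dA : dagger A = A + (w - w^*)%:M.
    by rewrite /A daggerB hH dagger_scalar raddfB/= addrA subrK.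
  have h1 : G *m dagger A *m dagger G = G.
    by rewrite -mulmxA -daggerM mulVmx// dagger_scalar rmorph1 mulmx1.
  rewrite -{1}h1 dA mulmxDr mulmxDl mulVmx// mul1mx [X in X - _]addrC addrK.
  by rewrite mul_mx_scalar -scalemxAl.
have ImG c : complex.Im (G c c) = complex.Im w * \sum_e nc (G c e) ^+ 2.
  have := congr1 (fun M : 'M[R[i]]_n => M c c) GE; rewrite [RHS]mxE mulmx_dagger_diag !mxE.
  rewrite !subcJ -mulrA -[RHS]mulrA -[X in _ = X]mulrA.
  move/(mulfI _); rewrite pnatr_eq0 => /(_ isT).
  rewrite mulrC [RHS]mulrA => h.
  have := congr1 (@complex.Im R) h; rewrite !ImM !ReM /=.
  by rewrite !(mulr0, mul0r, mulr1, mul1r, addr0, add0r, subr0, oppr0, sub0r).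
have iw0 : 0 < `|complex.Im w| by rewrite normr_gt0.
(* One term of the sum of squares in [ImG]. It is used with [e = c] to bound the diagonal, and then
   again to pass to the entry [a b]. *)
have le c e : `|complex.Im w| * nc (G c e) ^+ 2 <= nc (G c c).
  apply: le_trans (Im_le_normc _); rewrite ImG normrM ler_wpM2l//.
  rewrite ger0_norm ?sumr_ge0// => [|k _]; last exact: sqr_ge0.
  by rewrite (bigD1 e)//= lerDl sumr_ge0// => k _; exact: sqr_ge0.
have diag c : nc (G c c) <= `|complex.Im w|^-1.
  have [->|g0] := eqVneq (nc (G c c)) 0; first by rewrite invr_ge0.
  have gp : 0 < nc (G c c) by rewrite lt_neqAle eq_sym g0 normc_ge0.
  by rewrite -(ler_pM2l iw0) mulfV ?gt_eqF// -(ler_pM2r gp) mul1r -mulrA -expr2 le.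
rewrite -(@ler_pXn2r _ 2) ?nnegrE ?normc_ge0 ?invr_ge0//.
rewrite -(ler_pM2l iw0) (le_trans (le a b))// (le_trans (diag a))//.
by rewrite expr2 mulrA mulfV ?gt_eqF// mul1r.
Qed.
End Resolvent.
Arguments dagger {R m n}.
Arguments selfadj {R n}.

Section Smooth.
Context {R : realType} {n : nat}.
Local Notation nc := Normc.normc.
Local Notation Mat := 'M[R[i]]_n.

(** Only Hermitian values are tested, since the resolvent is controlled only there; all measurable
    spaces are allowed, to match [measurable_functional]. *)
Definition mfunctional (F : Mat -> R[i]) := forall d (T : measurableType d) (M : T -> Mat),
  (forall t, selfadj (M t)) -> (forall j k, cmeasurable (fun t => M t j k)) ->
  cmeasurable (fun t => F (M t)).

(* [DF M E] is the derivative of [F] at [M] in the direction [E]. On Hermitian matrices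
   [F] has a uniform first-order Taylor expansion with quadratic remainder, a condition
   stable under products and providing all the bounds needed for integration by parts;
   linearity in [E] is over the complex numbers, so that [E] may be a matrix unit. *)
Definition smooth (F : Mat -> R[i]) (DF : Mat -> Mat -> R[i]) :=
  [/\ mfunctional F, (forall E, mfunctional (DF ^~ E)),
    (forall M a E1 E2, DF M (a *: E1 + E2) = a * DF M E1 + DF M E2) &
    forall E, selfadj E -> exists K, forall M (u : R), selfadj M ->
      [/\ nc (F M) <= K, nc (F (M + u%:C *: E) - F M) <= K * `|u| &
        nc (F (M + u%:C *: E) - F M - u%:C * DF M E) <= K * u ^+ 2]].

Lemma smooth_cst c : smooth (fun=> c) (fun _ _ => 0).
Proof.
split => [? ? ? ? ?|? ? ? ? ? ?|? ? ? ?|E hE].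
- exact: cmeasurable_cst.
- exact: cmeasurable_cst.
- by rewrite mulr0 addr0.
- exists (nc c) => M u hM; rewrite subrr mulr0 subr0 Normc.normc0.
  by split => //; rewrite mulr_ge0 ?normc_ge0 ?sqr_ge0.
Qed.

Lemma smoothD F G DF DG : smooth F DF -> smooth G DG ->
  smooth (fun M => F M + G M) (fun M E => DF M E + DG M E).
Proof.
move=> [mF mDF lF bF] [mG mDG lG bG]; split.
- by move=> d T M hM mM /=; apply: cmeasurableD; [exact: mF|exact: mG].
- by move=> E d T M hM mM /=; apply: cmeasurableD; [exact: mDF|exact: mDG].
- by move=> M a E1 E2; rewrite lF lG; ring.
- move=> E hE; have [K bK] := bF E hE; have [L bL] := bG E hE.
  exists (K + L) => M u hM; have [K1 K2 K3] := bK M u hM; have [L1 L2 L3] := bL M u hM.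
  split.
  + by rewrite (le_trans (normcD _ _))// lerD.
  + by rewrite opprD addrACA (le_trans (normcD _ _))// mulrDl lerD.
  + set f' := F (M + _) in K2 K3 *; set g' := G (M + _) in L2 L3 *.
    have -> : f' + g' - (F M + G M) - u%:C * (DF M E + DG M E) =
      (f' - F M - u%:C * DF M E) + (g' - G M - u%:C * DG M E) by ring.
    by rewrite (le_trans (normcD _ _))// mulrDl lerD.
Qed.

Lemma smoothM F G DF DG : smooth F DF -> smooth G DG ->
  smooth (fun M => F M * G M) (fun M E => DF M E * G M + F M * DG M E).
Proof.
move=> [mF mDF lF bF] [mG mDG lG bG]; split.
- by move=> d T M hM mM /=; apply: cmeasurableM; [exact: mF|exact: mG].
- move=> E d T M hM mM /=; apply: cmeasurableD; apply: cmeasurableM;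
    [exact: mDF|exact: mG|exact: mF|exact: mDG].
- by move=> M a E1 E2; rewrite lF lG; ring.
- move=> E hE; have [K bK] := bF E hE; have [L bL] := bG E hE.
  (* One [K * L] for each of the three terms of the remainder: a Taylor remainder times the other
     function, twice, and the product of the two increments. *)
  exists (3 * (K * L)) => M u hM; have [K1 K2 K3] := bK M u hM;
    have [L1 L2 L3] := bL M u hM.
  have hM' : selfadj (M + u%:C *: E) by apply: selfadjD => //; exact: selfadjZ.
  have [L1' _ _] := bL _ u hM'.
  set f' := F (M + _) in K2 K3 *; set g' := G (M + _) in L1' L2 L3 *.
  have K0 := le_trans (normc_ge0 _) K1; have L0 := le_trans (normc_ge0 _) L1.
  have KL : 0 <= K * L by rewrite mulr_ge0.
  have n0 (z : R[i]) : 0 <= nc z by exact: normc_ge0.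
  have u0 : 0 <= `|u| by [].
  split.
  + by rewrite Normc.normcM (le_trans (ler_pM _ _ K1 L1))// ler_peMl// ler1n.
  + have -> : f' * g' - F M * G M = (f' - F M) * g' + F M * (g' - G M) by ring.
    rewrite (le_trans (normcD _ _))// !Normc.normcM.
    have h1 := ler_pM (n0 _) (n0 _) K2 L1'; have h2 := ler_pM (n0 _) (n0 _) K1 L2.
    by rewrite (le_trans (lerD h1 h2))//; nra.
  + have -> : f' * g' - F M * G M - u%:C * (DF M E * G M + F M * DG M E) =
      (f' - F M - u%:C * DF M E) * G M + F M * (g' - G M - u%:C * DG M E)
      + (f' - F M) * (g' - G M) by ring.
    rewrite (le_trans (normcD _ _))//.
    rewrite (le_trans (lerD (normcD _ _) (lexx _)))// !Normc.normcM.
    have h1 := ler_pM (n0 _) (n0 _) K3 L1; have h2 := ler_pM (n0 _) (n0 _) K1 L3.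
    have h3 := ler_pM (n0 _) (n0 _) K2 L2.
    rewrite (le_trans (lerD (lerD h1 h2) h3))//.
    have -> : u ^+ 2 = `|u| ^+ 2 by rewrite real_normK// num_real.
    by rewrite le_eqVlt; apply/orP; left; apply/eqP; ring.
Qed.

Lemma eq_smooth F G DF DG : smooth F DF -> (forall M, F M = G M) ->
  (forall M E, DF M E = DG M E) -> smooth G DG.
Proof.
move=> sF FG DFG.
have -> : G = F by apply/funext => M; rewrite FG.
by have -> : DG = DF by apply/funext => M; apply/funext => E; rewrite DFG.
Qed.

Lemma smooth_sum (I : Type) (r : seq I) (F : I -> Mat -> R[i]) DF :
  (forall i, smooth (F i) (DF i)) ->
  smooth (fun M => \sum_(i <- r) F i M) (fun M E => \sum_(i <- r) DF i M E).
Proof.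
move=> sF; elim: r => [|i r IH].
  by apply: (eq_smooth _ _ _ _ (smooth_cst 0)) => *; rewrite big_nil.
by apply: (eq_smooth _ _ _ _ (smoothD _ _ _ _ (sF i) IH)) => *; rewrite big_cons.
Qed.

Lemma smoothX F DF k : smooth F DF ->
  smooth (fun M => F M ^+ k) (fun M E => k%:R * F M ^+ k.-1 * DF M E).
Proof.
move=> sF; elim: k => [|k IH].
  by apply: (eq_smooth _ _ _ _ (smooth_cst 1)) => *; rewrite ?expr0 ?mul0r.
apply: (eq_smooth _ _ _ _ (smoothM _ _ _ _ sF IH)) => [M|M E]; first by rewrite exprS.
by rewrite -natr1; case: k {IH} => [|k] /=; rewrite ?exprS ?expr0; ring.
Qed.

Definition msmooth m p (F : Mat -> 'M[R[i]]_(m, p)) (DF : Mat -> Mat -> 'M[R[i]]_(m, p)) :=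
  forall a b, smooth (fun M => F M a b) (fun M E => DF M E a b).

Lemma msmoothM m p q (F : Mat -> 'M[R[i]]_(m, p)) (G : Mat -> 'M[R[i]]_(p, q)) DF DG :
  msmooth _ _ F DF -> msmooth _ _ G DG ->
  msmooth _ _ (fun M => F M *m G M) (fun M E => DF M E *m G M + F M *m DG M E).
Proof.
move=> sF sG a b.
apply: (eq_smooth _ _ _ _ (smooth_sum _ (index_enum _) _ _
  (fun k => smoothM _ _ _ _ (sF a k) (sG k b)))) => *; rewrite !mxE//.
by rewrite big_split.
Qed.

Lemma smooth_mxtrace (F : Mat -> Mat) DF : msmooth _ _ F DF ->
  smooth (fun M => \tr (F M)) (fun M E => \tr (DF M E)).
Proof. by move=> sF; apply: smooth_sum => k; exact: sF. Qed.

Lemma normc_mulmx m p q (A : 'M[R[i]]_(m, p)) (B : 'M[R[i]]_(p, q)) x y :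
  (forall a b, nc (A a b) <= x) -> (forall a b, nc (B a b) <= y) ->
  forall a b, nc ((A *m B) a b) <= p%:R * (x * y).
Proof.
move=> hA hB a b; rewrite mxE.
have -> : p%:R * (x * y) = \sum_(k < p) (x * y).
  by rewrite sumr_const card_ord mulr_natl.
elim/big_ind2: _ => [|z1 r1 z2 r2 h1 h2|k _]; first by rewrite Normc.normc0.
  by rewrite (le_trans (normcD _ _))// lerD.
by rewrite Normc.normcM ler_pM ?normc_ge0.
Qed.

(** The resolvent identity [G1 - G0 = - u s G1 E G0] gives the first-order bound; substituted into
    itself it leaves the remainder [(u s)^2 G1 E G0 E G0]. Uniformity in [M] comes from
    [resolvent_entry]. *)
Lemma msmooth_resolvent (s : R) (w : R[i]) : complex.Im w != 0 ->
  msmooth _ _ (fun M => invmx (s%:C *: M - w%:M))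
    (fun M E => let G := invmx (s%:C *: M - w%:M) in - s%:C *: (G *m E *m G)).
Proof.
move=> w0 a b; pose G (M : Mat) : Mat := invmx (s%:C *: M - w%:M).
have mG d (T : measurableType d) (M : T -> Mat) j k :
    (forall t, selfadj (M t)) -> (forall j k, cmeasurable (fun t => M t j k)) ->
    cmeasurable (fun t => G (M t) j k).
  move=> hM mM; apply: cmeasurable_invmx => [t|p q].
    by apply: resolvent_unit => //; exact: selfadjZ.
  under eq_fun do rewrite !mxE; apply: cmeasurableD; last exact: cmeasurable_cst.
  by apply: cmeasurableM; [exact: cmeasurable_cst|exact: mM].
split.
- by move=> d T M hM mM; exact: mG.
- move=> E d T M hM mM /=; under eq_fun do rewrite mxE.
  apply: cmeasurableM; first exact: cmeasurable_cst.
  under eq_fun do rewrite mxE; apply: cmeasurable_sum => k.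
  apply: cmeasurableM; last exact: mG.
  under eq_fun do rewrite mxE; apply: cmeasurable_sum => l.
  by apply: cmeasurableM; [exact: mG|exact: cmeasurable_cst].
- move=> M c E1 E2; rewrite /= mulmxDr mulmxDl -scalemxAr -scalemxAl !mxE.
  ring.
- move=> E hE; pose g := `|complex.Im w|^-1; pose e := \sum_j \sum_k nc (E j k).
  have Ee j k : nc (E j k) <= e.
    rewrite /e (bigD1 j)//= (bigD1 k)//= -addrA lerDl addr_ge0//.
      by rewrite sumr_ge0// => *; exact: normc_ge0.
    by rewrite sumr_ge0// => *; rewrite sumr_ge0// => *; exact: normc_ge0.
  pose N : R := n%:R.
  (* [g] bounds the entries of the resolvents and [e] those of [E]; each matrix product costs a
     factor [N]. The three summands serve the value, the increment and the remainder. *)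
  exists (g + `|s| * (N * ((N * (g * e)) * g)) + s ^+ 2 * (N * (N * (N * (N * (g * e) *
    g) * e) * g))).
  move=> M u hM; have hM' : selfadj (M + u%:C *: E) by apply: selfadjD => //;
    exact: selfadjZ.
  have bG M1 : selfadj M1 -> forall p q, nc (G M1 p q) <= g.
    by move=> h p q; apply: resolvent_entry => //; exact: selfadjZ.
  have uG M1 : selfadj M1 -> s%:C *: M1 - w%:M \in unitmx.
    by move=> h; apply: resolvent_unit => //; exact: selfadjZ.
  pose G1 := G (M + u%:C *: E); pose G0 := G M.
  have e1 : G1 - G0 = - (u * s)%:C *: (G1 *m E *m G0).
    have : G1 *m ((s%:C *: M - w%:M) - (s%:C *: (M + u%:C *: E) - w%:M)) *m G0 = G1 - G0.
      rewrite mulmxBr mulmxBl mulVmx ?uG// mul1mx -mulmxA mulmxV ?uG// mulmx1.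
      by [].
    move=> <-.
    have -> : (s%:C *: M - w%:M) - (s%:C *: (M + u%:C *: E) - w%:M) = - (u * s)%:C *: E.
      by apply/matrixP => p q; rewrite !mxE rmorphM/=; ring.
    by rewrite -scalemxAr -scalemxAl.
  have e2 : G1 - G0 - u%:C *: (- s%:C *: (G0 *m E *m G0)) =
      (u * s)%:C ^+ 2 *: (G1 *m E *m G0 *m E *m G0).
    have -> : u%:C *: (- s%:C *: (G0 *m E *m G0)) = - (u * s)%:C *: (G0 *m E *m G0).
      by rewrite scalerA mulrN rmorphM.
    rewrite {1}e1 -scalerBr -!mulmxBl e1 expr2 -!scalemxAl scalerA.
    by rewrite mulrNN ?mulmxA.
  have b1 := normc_mulmx _ _ _ G1 E g e (bG _ hM') Ee.
  have b2 := normc_mulmx _ _ _ _ G0 _ g b1 (bG _ hM).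
  have b3 := normc_mulmx _ _ _ _ E _ e b2 Ee.
  have b4 := normc_mulmx _ _ _ _ G0 _ g b3 (bG _ hM).
  have g0 : 0 <= g by rewrite invr_ge0.
  have e0 : 0 <= e by rewrite sumr_ge0// => *; rewrite sumr_ge0// => *; exact: normc_ge0.
  have N0 : 0 <= N by [].
  have k2 : 0 <= N * ((N * (g * e)) * g) by rewrite !mulr_ge0.
  have k3 : 0 <= N * (N * (N * (N * (g * e) * g) * e) * g) by rewrite !mulr_ge0.
  split.
  + rewrite (le_trans (bG _ hM _ _))// -addrA lerDl addr_ge0// mulr_ge0//.
    exact: sqr_ge0.
  + have -> : invmx (s%:C *: (M + u%:C *: E) - w%:M) a b - invmx (s%:C *: M - w%:M) a b =
    (G1 - G0) a b.
      by rewrite !mxE.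
    rewrite e1 mxE Normc.normcM normcN normcR normrM -[X in X <= _]mulrA [X in X <=
      _]mulrC ler_wpM2r//.
    rewrite (le_trans (ler_wpM2l _ (b2 a b)))// -addrA addrC -addrA lerDl addr_ge0//.
    by rewrite mulr_ge0 ?sqr_ge0.
  + have -> : invmx (s%:C *: (M + u%:C *: E) - w%:M) a b - invmx (s%:C *: M - w%:M) a b
        - u%:C * (- s%:C *: (G0 *m E *m G0)) a b =
          (G1 - G0 - u%:C *: (- s%:C *: (G0 *m E *m G0))) a b.
      by rewrite !mxE.
    rewrite e2 mxE Normc.normcM expr2 Normc.normcM normcR -expr2 real_normK ?num_real//.
    rewrite exprMn -[X in X <= _]mulrA [X in X <= _]mulrC ler_wpM2r ?sqr_ge0//.
    rewrite (le_trans (ler_wpM2l _ (b4 a b))) ?sqr_ge0// lerDr addr_ge0//.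
    by rewrite mulr_ge0.
Qed.

End Smooth.

Section QuadraticDerivative.
Context {R : realType}.
Local Open Scope classical_set_scope.

Lemma is_derive_quadratic (f : R -> R) (u g K : R) :
  (forall h, `|f (u + h) - f u - h * g| <= K * h ^+ 2) -> is_derive u (1 : R) f g.
Proof.
move=> fK.
have K0 : 0 <= K by have := le_trans (normr_ge0 _) (fK 1); rewrite expr1n mulr1.
have lim : (fun h : R => h^-1 *: (f (h *: (1 : R) + u) - f u)) @ 0^' --> g.
  apply/cvgrPdist_le => e e0.
  exists (e / (K + 1)); first by rewrite /= divr_gt0// ltr_wpDl.
  move=> h /=; rewrite sub0r normrN => hd h0.
  have -> : g - h^-1 *: (f (h *: (1 : R) + u) - f u) = - (h^-1 * (f (u + h) - f u - h * g)).
    by rewrite /GRing.scale/= mulr1 [h + u]addrC; field.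
  rewrite normrN normrM normfV ler_pdivrMl ?normr_gt0//.
  rewrite (le_trans (fK h))// -[h ^+ 2]real_normK ?num_real// expr2 mulrCA ler_wpM2l//.
  move: hd; rewrite ltr_pdivlMr ?ltr_wpDl// => /ltW; apply: le_trans.
  by rewrite mulrC ler_wpM2l// lerDl.
split; first by apply/cvg_ex; exists g; exact: lim.
exact: (cvg_lim _ lim).
Qed.

Lemma continuous_lipschitz (g : R -> R) (K : R) :
  (forall u v, `|g v - g u| <= K * `|v - u|) -> continuous g.
Proof.
move=> gK u; apply/cvgrPdist_le => e e0.
have K0 : 0 <= K.
  by have := le_trans (normr_ge0 _) (gK 0 1); rewrite subr0 normr1 mulr1.
exists (e / (K + 1)); first by rewrite /= divr_gt0// ltr_wpDl.
move=> v /=; rewrite ltr_pdivlMr ?ltr_wpDl// => /ltW vd.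
rewrite (le_trans (gK v u))// (le_trans _ vd)// mulrC ler_wpM2l//.
by rewrite lerDl.
Qed.
End QuadraticDerivative.

Section Line.
Context {R : realType} {n : nat}.
Local Notation nc := Normc.normc.
Local Notation Mat := 'M[R[i]]_n.

(** Both bounds on [DF] follow from the expansion of [F], at the cost of a factor 2. At step 1, [DF]
    is the increment minus the remainder. Adding the expansions from [u] to [v] and back cancels the
    values of [F] and leaves [(v - u) (Dv - Du)] as a sum of two quadratic remainders. *)
Lemma smooth_line (F : Mat -> R[i]) DF E : smooth F DF -> selfadj E ->
  exists K, forall M, selfadj M ->
    [/\ nc (F M) <= K, nc (DF M E) <= K,
     forall u h : R, nc (F (M + (u + h)%:C *: E) - F (M + u%:C *: E) -
        h%:C * DF (M + u%:C *: E) E) <= K * h ^+ 2 &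
     forall u v : R, nc (DF (M + v%:C *: E) E - DF (M + u%:C *: E) E) <= K * `|v - u|].
Proof.
move=> [_ _ _ bF] hE; have [K bK] := bF E hE.
exists (2 * K) => M hM.
have K0 : 0 <= K by have [h _ _] := bK M 0 hM; rewrite (le_trans (normc_ge0 _) h).
have hM' (u : R) : selfadj (M + u%:C *: E) by apply: selfadjD => //; exact: selfadjZ.
have ME (u h : R) : M + (u + h)%:C *: E = M + u%:C *: E + h%:C *: E.
  by rewrite rmorphD/= scalerDl addrA.
have Q (u h : R) : nc (F (M + (u + h)%:C *: E) - F (M + u%:C *: E) -
        h%:C * DF (M + u%:C *: E) E) <= K * h ^+ 2.
  by rewrite ME; have [] := bK _ h (hM' u).
split.
- by have [h _ _] := bK M 0 hM; rewrite (le_trans h)// ler_peMl// ler1n.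
- have [_ h1 h2] := bK M 1 hM.
  move: h1 h2; rewrite normr1 expr1n mulr1 scale1r mul1r => h1 h2.
  have -> : DF M E = (F (M + E) - F M) - (F (M + E) - F M - DF M E) by ring.
  by rewrite (le_trans (normcB _ _))//; lra.
- by move=> u h; rewrite (le_trans (Q u h))// ler_wpM2r ?sqr_ge0// ler_peMl// ler1n.
- move=> u v; have [->|uv] := eqVneq v u.
    by rewrite !subrr Normc.normc0 normr0 mulr0.
  have d0 : 0 < `|v - u| by rewrite normr_gt0 subr_eq0.
  rewrite -(ler_pM2l d0) -{1}normcR -Normc.normcM.
  have h1 := Q u (v - u); have h2 := Q v (u - v).
  move: h1 h2; rewrite ![_ + (_ - _)]addrC !subrK => h1 h2.
  set Fu := F (M + u%:C *: E) in h1 h2; set Fv := F (M + v%:C *: E) in h1 h2.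
  set Du := DF (M + u%:C *: E) E in h1 *; set Dv := DF (M + v%:C *: E) E in h2 *.
  have -> : (v - u)%:C * (Dv - Du) =
    (Fv - Fu - (v - u)%:C * Du) + (Fu - Fv - (u - v)%:C * Dv).
    by rewrite !rmorphB/=; ring.
  rewrite (le_trans (normcD _ _))// (le_trans (lerD h1 h2))//.
  have -> : (u - v) ^+ 2 = `|v - u| ^+ 2 by rewrite real_normK ?num_real// -sqrrN opprB.
  have -> : (v - u) ^+ 2 = `|v - u| ^+ 2 by rewrite real_normK ?num_real.
  by rewrite le_eqVlt; apply/orP; left; apply/eqP; ring.
Qed.
End Line.

(** * Real coordinates on Hermitian matrices *)

Section HermitianMatrix.
Context {R : realType} {n : nat}.
Local Notation I := ('I_n * 'I_n * bool)%type.

(** Reads only the coordinates in [gue_index] and is Hermitian for every [c], so that changing one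
    coordinate moves along a line of Hermitian matrices. *)
Definition herm_of (c : I -> R) : 'M[R[i]]_n := \matrix_(j, k)
  if (j < k)%N then c (j, k, false) +i* c (j, k, true)
  else if (k < j)%N then c (k, j, false) +i* (- c (k, j, true)) else (c (j, j, false))%:C.

Definition herm_dir (i : I) : 'M[R[i]]_n := herm_of (fun j => (j == i)%:R).

Lemma herm_of_upd i v c : herm_of (upd i v c) = herm_of (upd i 0 c) + v%:C *: herm_dir i.
Proof.
have u j : upd i v c j = upd i 0 c j + v * (j == i)%:R.
  by rewrite /upd; case: eqP => _; rewrite ?mulr0 ?addr0 ?mulr1 ?add0r.
apply/matrixP => j k; rewrite !mxE.
by case: ifP => _; [|case: ifP => _]; rewrite !u; apply: complexP => /=; ring.
Qed.

Lemma selfadj_herm_of c : selfadj (herm_of c).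
Proof.
apply/matrixP => j k; rewrite !mxE; case: (ltngtP j k) => jk //=.
- by rewrite opprK.
- by rewrite oppr0 (ord_inj jk).
Qed.

Lemma cmeasurable_herm_of {d} {T : measurableType d} (Y : I -> T -> R) :
  (forall i, measurable_fun setT (Y i)) ->
  forall j k, cmeasurable (fun t => herm_of (Y ^~ t) j k).
Proof.
move=> mY j k; split; under eq_fun do rewrite mxE;
  case: (j < k)%N => /=; [exact: mY| |exact: mY|]; case: (k < j)%N => /=.
- exact: mY.
- exact: mY.
- by apply: measurable_funN; exact: mY.
- exact: measurable_cst.
Qed.

(* The complex combinations of the two real directions are the non-Hermitian matrix
   units, as for Wirtinger derivatives. *)
Lemma herm_dir_offdiag (j k : 'I_n) : (j < k)%N ->
  herm_dir (j, k, false) + 'i *: herm_dir (j, k, true) = 2 *: delta_mx k j /\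
  herm_dir (j, k, false) - 'i *: herm_dir (j, k, true) = 2 *: delta_mx j k.
Proof.
move=> jk; split; apply/matrixP => a b; rewrite !mxE !xpair_eqE /= !andbT !andbF;
  case: (ltngtP a b) => ab; case: (eqVneq a j) => [?|_]; case: (eqVneq a k) => [?|_];
  case: (eqVneq b j) => [?|_]; case: (eqVneq b k) => [?|_]; subst;
  by [exfalso; lia|apply: complexP => /=; ring].
Qed.

Lemma herm_dir_diag (j : 'I_n) : herm_dir (j, j, false) = delta_mx j j.
Proof.
apply/matrixP => a b; rewrite !mxE !xpair_eqE /= !andbT !andbF.
case: (ltngtP a b) => ab; last by rewrite (ord_inj ab); case: (b == j).
all: case: (eqVneq a j) => [?|_]; case: (eqVneq b j) => [?|_]; subst;
  by [exfalso; lia|apply: complexP; rewrite /= ?oppr0].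
Qed.

End HermitianMatrix.

(** * Integration by parts for GUE entries *)

Section ComplexExpectation.
Context {R : realType} {d : measure_display} {T : measurableType d} (P : probability T R).
Local Notation nc := Normc.normc.
Implicit Types (f g : T -> R[i]).

Definition cintegrable f :=
  P.-integrable setT (fun t => (complex.Re (f t))%:E) /\
  P.-integrable setT (fun t => (complex.Im (f t))%:E).

Lemma cintegrable_bounded f K : cmeasurable f -> (forall t, nc (f t) <= K) -> cintegrable f.
Proof.
move=> [mRe mIm] fK; split; apply: (@le_integrable _ _ _ P setT _ _ (fun=> K%:E)) => //.
- exact/measurable_EFinP.
- move=> t _; rewrite !abse_EFin lee_fin (le_trans (Re_le_normc _))//.
  by rewrite (le_trans (fK _))// ler_norm.
- exact: finite_measure_integrable_cst.
- exact/measurable_EFinP.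
- move=> t _; rewrite !abse_EFin lee_fin (le_trans (Im_le_normc _))//.
  by rewrite (le_trans (fK _))// ler_norm.
- exact: finite_measure_integrable_cst.
Qed.

Lemma cintegrableD f g : cintegrable f -> cintegrable g -> cintegrable (fun t => f t + g t).
Proof.
move=> [f1 f2] [g1 g2]; split.
- by apply: eq_integrable (integrableD measurableT f1 g1) => // t _; rewrite ReD EFinD.
- by apply: eq_integrable (integrableD measurableT f2 g2) => // t _; rewrite ImD EFinD.
Qed.

Lemma cintegrableZ f (c : R[i]) : cintegrable f -> cintegrable (fun t => c * f t).
Proof.
move=> [f1 f2]; split.
- apply: eq_integrable (integrableB measurableT (integrableZl measurableT (complex.Re c) f1)
    (integrableZl measurableT (complex.Im c) f2)) => // t _.
  by rewrite ReM EFinB !EFinM.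
- apply: eq_integrable (integrableD measurableT (integrableZl measurableT (complex.Re c) f2)
    (integrableZl measurableT (complex.Im c) f1)) => // t _.
  by rewrite ImM EFinD !EFinM.
Qed.

Lemma cexpectD f g : cintegrable f -> cintegrable g ->
  cexpect P (fun t => f t + g t) = cexpect P f + cexpect P g.
Proof.
move=> [f1 f2] [g1 g2]; apply: complexP; rewrite ?ReD ?ImD /= -RintegralD//.
- by apply: eq_Rintegral => t _; rewrite ReD.
- by apply: eq_Rintegral => t _; rewrite ImD.
Qed.

Lemma cexpectZ f (c : R[i]) : cintegrable f ->
  cexpect P (fun t => c * f t) = c * cexpect P f.
Proof.
move=> [f1 f2]; have mT := @measurableT _ T.
have lin (a b : R) (u v : T -> R) : P.-integrable setT (fun t => (u t)%:E) ->
    P.-integrable setT (fun t => (v t)%:E) ->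
    Rintegral P setT (fun t => a * u t + b * v t) =
      a * Rintegral P setT u + b * Rintegral P setT v.
  move=> iu iv; rewrite RintegralD ?RintegralZl//.
  - exact: eq_integrable (integrableZl mT a iu).
  - exact: eq_integrable (integrableZl mT b iv).
apply: complexP; rewrite ?ReM ?ImM /= -?mulNr -lin//; apply: eq_Rintegral => t _.
- by rewrite ReM mulNr.
- by rewrite ImM.
Qed.

Lemma cexpect_cst (c : R[i]) : cexpect P (fun=> c) = c.
Proof.
by apply: complexP; rewrite /= Rintegral_cst//= probability_setT mulr1.
Qed.

Lemma cintegrable_cst (c : R[i]) : cintegrable (fun=> c).
Proof. exact: (cintegrable_bounded _ (nc c) (cmeasurable_cst _)). Qed.

Lemma cintegrable_sum (I : Type) (r : seq I) (F : I -> T -> R[i]) :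
  (forall i, cintegrable (F i)) -> cintegrable (fun t => \sum_(i <- r) F i t).
Proof.
move=> iF; elim: r => [|i r IH].
  have -> : (fun t => \sum_(i <- [::]) F i t) = fun=> 0 by apply/funext => t;
    rewrite big_nil.
  exact: cintegrable_cst.
have -> : (fun t => \sum_(j <- i :: r) F j t) = fun t => F i t + \sum_(j <- r) F j t.
  by apply/funext => t; rewrite big_cons.
exact: cintegrableD.
Qed.

Lemma cexpect_sum (I : Type) (r : seq I) (F : I -> T -> R[i]) :
  (forall i, cintegrable (F i)) ->
  cexpect P (fun t => \sum_(i <- r) F i t) = \sum_(i <- r) cexpect P (F i).
Proof.
move=> iF; elim: r => [|i r IH].
  rewrite big_nil -[RHS](cexpect_cst 0); congr (cexpect P _).
  by apply/funext => t; rewrite big_nil.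
rewrite big_cons -IH -cexpectD//; last exact: cintegrable_sum.
by congr (cexpect P _); apply/funext => t; rewrite big_cons.
Qed.

End ComplexExpectation.

Section GUE.
Context {R : realType} {d : measure_display} {T : measurableType d} {P : probability T R}.
Context {n : nat} (x y : 'I_n -> 'I_n -> {RV P >-> R}).
Hypothesis xyGUE : is_GUE x y.
Local Notation I := ('I_n * 'I_n * bool)%type.
Local Notation nc := Normc.normc.

(** The coordinates that [herm_of] does not read are set to 0, as the constancy hypothesis of
    [gaussian_ibp] requires. *)
Definition gue_var (i : I) : T -> R :=
  if i \in gue_index n then (if i.2 then (y i.1.1 i.1.2 : T -> R) else x i.1.1 i.1.2)
  else cst 0.

Definition gue_mx (t : T) : 'M[R[i]]_n := herm_of (gue_var ^~ t).

Lemma gue_mxE t : gue_mx t = \matrix_(j, k) ((x j k t) +i* (y j k t)).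
Proof.
have [sym y0 _ _ _] := xyGUE.
apply/matrixP => j k; rewrite !mxE /gue_var !inE /= !eqxx !andbF !andbT !orbF !orbT.
case: (ltngtP j k) => jk /=.
- by [].
- by have [-> ->] := sym k j t.
- by rewrite (ord_inj jk) y0.
Qed.

Lemma selfadj_gue t : selfadj (gue_mx t). Proof. exact: selfadj_herm_of. Qed.

Lemma measurable_gue_var i : measurable_fun setT (gue_var i).
Proof. by rewrite /gue_var; case: ifP => _; [case: ifP => _|]. Qed.

Lemma cmeasurable_gue (F : 'M[R[i]]_n -> R[i]) : mfunctional F ->
  cmeasurable (fun t => F (gue_mx t)).
Proof.
move=> mF; apply: mF => [t|j k]; first exact: selfadj_gue.
by apply: cmeasurable_herm_of; exact: measurable_gue_var.
Qed.

Lemma gue_var_independent : mutually_independent P (gue_index n) gue_var.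
Proof.
have [_ _ _ _ ind] := xyGUE.
move=> J B JS mB; have := ind J B JS mB.
have E i : i \in J -> gue_var i = if i.2 then (y i.1.1 i.1.2 : T -> R) else x i.1.1 i.1.2.
  by move=> /(fintype.subsetP JS) iS; rewrite /gue_var iS.
move=> h; rewrite [RHS](eq_bigr _ (fun i iJ => congr1 (fun f => P (f @^-1` B i)%classic)
  (E i iJ))).
rewrite -h; congr (P _); apply/seteqP; split => t /= h' i iJ; have := h' i iJ; by rewrite E.
Qed.

Lemma ibp_var F DF i s : smooth F DF -> i \in gue_index n -> s != 0 ->
  (forall A, measurable A -> P (gue_var i @^-1` A)%classic = normal_prob 0 s A) ->
  [/\ cintegrable P (fun t => (gue_var i t)%:C * F (gue_mx t)),
      cintegrable P (fun t => DF (gue_mx t) (herm_dir i)) &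
      cexpect P (fun t => (gue_var i t)%:C * F (gue_mx t)) =
      (s ^+ 2)%:C * cexpect P (fun t => DF (gue_mx t) (herm_dir i))].
Proof.
move=> sF iS s0 law; have [mF mDF _ _] := sF.
have [K bK] := smooth_line F DF (herm_dir i) sF (selfadj_herm_of _).
have m1 j := measurable_gue_var j.
have X0 j : j \notin gue_index n -> gue_var j = cst 0 by move=> /negPf h;
  rewrite /gue_var h.
have line (c : I -> R) (u : R) : herm_of (upd i u c) =
  herm_of (upd i 0 c) + u%:C *: herm_dir i by exact: herm_of_upd.
have H0 (c : I -> R) : selfadj (herm_of (upd i 0 c)) by exact: selfadj_herm_of.
(* Real integration by parts is applied to the real and the imaginary part of [F]; [pr b] treats
   both at once, being compatible with differences and real scalars. *)
pose pr (b : bool) (z : R[i]) := if b then complex.Re z else complex.Im z.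
have prle b z : `|pr b z| <= nc z.
  by case: b; [exact: Re_le_normc|exact: Im_le_normc].
have prB b z w : pr b (z - w) = pr b z - pr b w.
  by case: b; rewrite /pr ?ReD ?ImD ?ReN ?ImN.
have prZ b (r : R) z : pr b (r%:C * z) = r * pr b z.
  by case: b; rewrite /pr ?ReM ?ImM /= mul0r ?subr0 ?addr0.
pose phi b (c : I -> R) := pr b (F (herm_of c)).
pose psi b (c : I -> R) := pr b (DF (herm_of c) (herm_dir i)).
have mphi b : measurable_functional (phi b).
  move=> d' T' Y mY; have [] : cmeasurable (fun t => F (herm_of (Y ^~ t))).
    by apply: mF => [t|]; [exact: selfadj_herm_of|exact: cmeasurable_herm_of].
  by rewrite /phi /pr; case: b.
have mpsi b : measurable_functional (psi b).
  move=> d' T' Y mY; have [] : cmeasurable (fun t => DF (herm_of (Y ^~ t)) (herm_dir i)).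
    by apply: (mDF (herm_dir i)) => [t|];
      [exact: selfadj_herm_of|exact: cmeasurable_herm_of].
  by rewrite /psi /pr; case: b.
have phiK b c : `|phi b c| <= K.
  by rewrite (le_trans (prle _ _))//; have [] := bK _ (selfadj_herm_of c).
have psiK b c : `|psi b c| <= K.
  by rewrite (le_trans (prle _ _))//; have [] := bK _ (selfadj_herm_of c).
have dphi b c u : is_derive u (1 : R) (fun v => phi b (upd i v c)) (psi b (upd i u c)).
  apply: (is_derive_quadratic _ _ _ K) => h; rewrite /phi /psi -prZ -!prB.
  rewrite (le_trans (prle _ _))//; have [_ _ Q _] := bK _ (H0 c).
  by rewrite (line c (u + h)) (line c u); exact: Q.
have cpsi b c : continuous (fun u => psi b (upd i u c)).
  apply: (continuous_lipschitz _ K) => u v; rewrite /psi -prB (le_trans (prle _ _))//.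
  by have [_ _ _ L] := bK _ (H0 c); rewrite (line c u) (line c v); exact: L.
have ibp b := gaussian_ibp P _ (gue_index n) gue_var i m1 iS X0 gue_var_independent s s0 law
  (phi b) (psi b) K (mphi b) (mpsi b) (phiK b) (psiK b) (dphi b) (cpsi b).
have int b := integrable_gaussianM P _ gue_var i m1 s s0 law (phi b) K (mphi b) (phiK b).
split.
- split; [apply: eq_integrable (int true)|apply: eq_integrable (int false)] => // t _.
    by rewrite -[complex.Re _]/(pr true _) prZ.
  by rewrite -[complex.Im _]/(pr false _) prZ.
- apply: (cintegrable_bounded _ _ K).
    exact: cmeasurable_gue (mDF (herm_dir i)).
  by move=> t; have [] := bK _ (selfadj_gue t).
- apply: complexP.
  + rewrite ReM /= mul0r subr0 -[RHS](ibp true); apply: eq_Rintegral => t _.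
    by rewrite -[complex.Re _]/(pr true _) prZ.
  + rewrite ImM /= mul0r addr0 -[RHS](ibp false); apply: eq_Rintegral => t _.
    by rewrite -[complex.Im _]/(pr false _) prZ.
Qed.

Lemma ibp_entry F DF j k : smooth F DF ->
  [/\ cintegrable P (fun t => gue_mx t j k * F (gue_mx t)),
      cintegrable P (fun t => DF (gue_mx t) (delta_mx k j)) &
      cexpect P (fun t => gue_mx t j k * F (gue_mx t)) =
      cexpect P (fun t => DF (gue_mx t) (delta_mx k j))].
Proof.
move=> sF; have [_ _ lawo lawd _] := xyGUE; have [_ _ linD _] := sF.
have off (a b : 'I_n) (e : R[i]) : (a < b)%N -> e ^+ 2 = -1 ->
    let D := 2^-1 *: (herm_dir (a, b, false) + e *: herm_dir (a, b, true)) in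
    let m t := (gue_var (a, b, false) t)%:C + e * (gue_var (a, b, true) t)%:C in
  [/\ cintegrable P (fun t => m t * F (gue_mx t)),
      cintegrable P (fun t => DF (gue_mx t) D) &
      cexpect P (fun t => m t * F (gue_mx t)) = cexpect P (fun t => DF (gue_mx t) D)].
  (* [e] will be ['i] above the diagonal and [- 'i] below it. The variance 1/2 of both parts becomes
     the factor [2^-1] in [D], which makes [D] a matrix unit by [herm_dir_offdiag]. *)
  move=> ab e2 D m; have [lx ly] := lawo a b ab.
  have s0 : Num.sqrt (2^-1 : R) != 0 by rewrite gt_eqF// sqrtr_gt0.
  have iS c : (a, b, c) \in gue_index n by rewrite inE /= ab.
  have vx : gue_var (a, b, false) = x a b by rewrite /gue_var iS.
  have vy : gue_var (a, b, true) = y a b by rewrite /gue_var iS.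
  have lawx A : measurable A ->
    P (gue_var (a, b, false) @^-1` A)%classic = normal_prob 0 (Num.sqrt (2^-1)) A.
    by rewrite vx; exact: lx.
  have lawy A : measurable A ->
    P (gue_var (a, b, true) @^-1` A)%classic = normal_prob 0 (Num.sqrt (2^-1)) A.
    by rewrite vy; exact: ly.
  have [i1 j1 E1] := ibp_var F DF _ _ sF (iS false) s0 lawx.
  have [i2 j2 E2] := ibp_var F DF _ _ sF (iS true) s0 lawy.
  have half_sqr : (Num.sqrt (2^-1 : R) ^+ 2)%:C = 2^-1.
    by rewrite sqr_sqrtr// fmorphV rmorphMn.
  rewrite half_sqr in E1 E2.
  have mE : (fun t => m t * F (gue_mx t)) =
      (fun t => (gue_var (a, b, false) t)%:C * F (gue_mx t) + e * ((gue_var (a, b, true)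
        t)%:C * F (gue_mx t))).
    by apply/funext => t; rewrite /m; ring.
  have DE : (fun t => DF (gue_mx t) D) =
      (fun t => 2^-1 * (DF (gue_mx t) (herm_dir (a, b, false)) + e * DF (gue_mx t)
        (herm_dir (a, b, true)))).
    apply/funext => t; rewrite /D -[2^-1 *: _]addr0 linD [_ + e *: _]addrC linD.
    have -> : DF (gue_mx t) 0 = 0.
      have := linD (gue_mx t) (-1) 0 0; rewrite scaler0 addr0 => {1}->; ring.
    by rewrite addr0 addrC.
  have ej2 := cintegrableZ P _ e j2; have ei2 := cintegrableZ P _ e i2.
  rewrite mE DE; split.
  - exact: cintegrableD.
  - by apply: cintegrableZ; exact: cintegrableD.
  - rewrite cexpectD// cexpectZ// cexpectZ; last exact: cintegrableD.
    by rewrite cexpectD// cexpectZ// E1 E2; ring.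
have half (A B : 'M[R[i]]_n) : A = 2 *: B -> 2^-1 *: A = B.
  by move=> ->; rewrite scalerA mulVf ?pnatr_eq0// scale1r.
case: (ltngtP j k) => jk.
- have := off j k 'i jk _; rewrite /= expr2 => /(_ _)[|].
    by apply: complexP => /=; ring.
  rewrite (half _ _ (herm_dir_offdiag _ _ jk).1).
  have -> : (fun t =>
      ((gue_var (j, k, false) t)%:C + 'i * (gue_var (j, k, true) t)%:C) * F (gue_mx t)) =
    (fun t => gue_mx t j k * F (gue_mx t)).
    apply/funext => t; congr (_ * _); rewrite mxE jk; apply: complexP => /=; ring.
  by [].
- have := off k j (- 'i) jk _; rewrite /= expr2 => /(_ _)[|].
    by apply: complexP => /=; ring.
  rewrite scaleNr (half _ _ (herm_dir_offdiag _ _ jk).2).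
  have -> : (fun t =>
      ((gue_var (k, j, false) t)%:C + - 'i * (gue_var (k, j, true) t)%:C) * F (gue_mx t)) =
    (fun t => gue_mx t j k * F (gue_mx t)).
    apply/funext => t; congr (_ * _); rewrite mxE ltnNge (ltnW jk)/= jk;
      apply: complexP => /=; ring.
  by [].
- rewrite (ord_inj jk); have iS : (k, k, false) \in gue_index n by rewrite inE /= eqxx orbT.
  have vx : gue_var (k, k, false) = x k k by rewrite /gue_var iS.
  have lawx A : measurable A ->
    P (gue_var (k, k, false) @^-1` A)%classic = normal_prob 0 1 A.
    by rewrite vx; exact: lawd.
  have := ibp_var F DF _ _ sF iS (oner_neq0 _) lawx.
  rewrite expr1n mul1r herm_dir_diag.
  have -> : (fun t => (gue_var (k, k, false) t)%:C * F (gue_mx t)) =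
    (fun t => gue_mx t k k * F (gue_mx t)) by apply/funext => t; rewrite mxE ltnn.
  by [].
Qed.
End GUE.

(** * The loop equation *)

Section Observables.
Context {R : realType} {n : nat} (z : R[i]).
Hypothesis n_gt0 : (0 < n)%N.
Hypothesis Imz : complex.Im z != 0.
Local Notation Mat := 'M[R[i]]_n.
Implicit Types (M E : Mat) (K : seq nat).

Let s : R := n%:R `^ (- 2^-1).
Let w : R[i] := 2 + z * npow n (- (2 / 3)).
Let q : R[i] := npow n (3^-1).

Definition resolvent_at M : Mat := invmx (npow n (- 2^-1) *: M - w%:M).

Definition gobs l M : R[i] :=
  if l == 1%N then npow n (- (2 / 3)) * (n%:R + \tr (resolvent_at M))
  else npow n (- (2 * l%:R / 3)) * \tr (resolvent_at M ^+ l).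

Lemma npow_third_neq0 : q != 0.
Proof. by apply/eqP => -[/eqP]; rewrite gt_eqF ?powR_gt0 ?ltr0n. Qed.

Lemma npow_thirds k : npow n (- (k%:R / 3)) = (q ^+ k)^-1.
Proof.
rewrite /q /npow mulrC powRN powRrM powR_mulrn ?powR_ge0//.
by rewrite fmorphV rmorphXn.
Qed.

Lemma cube_npow_third : q ^+ 3 = n%:R.
Proof.
rewrite /q /npow -rmorphXn/= -powR_mulrn ?powR_ge0// -powRrM mulVf ?pnatr_eq0//.
by rewrite powRr1// rmorph_nat.
Qed.

Lemma sqr_npow_half : npow n (- 2^-1) ^+ 2 = (q ^+ 3)^-1.
Proof.
rewrite cube_npow_third /npow -rmorphXn/= -powR_mulrn ?powR_ge0// -powRrM mulNr mulVf
  ?pnatr_eq0//.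
by rewrite powRN powRr1// fmorphV rmorph_nat.
Qed.

Lemma npow23 : npow n (- (2 / 3)) = (q ^+ 2)^-1.
Proof. exact: (npow_thirds 2). Qed.

Lemma npow2l l : npow n (- (2 * l%:R / 3)) = (q ^+ (2 * l))^-1.
Proof. by rewrite -natrM npow_thirds. Qed.

Lemma Imw : complex.Im w != 0.
Proof.
have Im2 : complex.Im (2 : R[i]) = 0 by rewrite -(rmorph_nat (real_complex R)).
rewrite /w ImD Im2 add0r ImM /= mulr0 add0r.
by rewrite mulf_neq0// gt_eqF ?powR_gt0 ?ltr0n.
Qed.

Lemma msmooth_resolvent_at : msmooth _ _ resolvent_at
  (fun M E => - npow n (- 2^-1) *: (resolvent_at M *m E *m resolvent_at M)).
Proof. exact: (msmooth_resolvent s w Imw). Qed.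

Lemma msmooth_resolvent_atX l : msmooth _ _ (fun M => resolvent_at M ^+ l)
  (fun M E => - npow n (- 2^-1) *: \sum_(i < l) (resolvent_at M ^+ i.+1 *m E *m
    resolvent_at M ^+ (l - i))).
Proof.
elim: l => [|l IH].
  move=> a b; apply: (eq_smooth _ _ _ _ (smooth_cst ((1 : Mat) a b))) => // M E.
  by rewrite big_ord0 scaler0 mxE.
move=> a b; apply: (eq_smooth _ _ _ _ (msmoothM _ _ _ _ _ _ _ msmooth_resolvent_at IH a
  b)) => [M|M E].
  by rewrite exprS.
congr (fun_of_matrix _ a b); rewrite big_ord_recl expr1 subn0 scalerDr -scalemxAl.
congr (_ + _); first by rewrite -mulmxA exprS.
rewrite -scalemxAr; congr (_ *: _); rewrite mulmx_sumr; apply: eq_bigr => i _.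
by rewrite !lift0 subSS !mulmxA -[resolvent_at M *m _]exprS.
Qed.

(** One formula for both branches of [gobs]: the centering constant [n] at [l = 1] has zero
    derivative, and both normalizations are [n^(-2l/3)]. *)
Definition Dgobs l M E : R[i] :=
  - npow n (- (2 * l%:R / 3)) * npow n (- 2^-1) * l%:R * \tr (resolvent_at M ^+ l.+1 *m E).

(** The Leibniz rule for [G^l] yields [l] terms, all equal under the trace by cyclicity. *)
Lemma smooth_trX l : smooth (fun M => \tr (resolvent_at M ^+ l))
  (fun M E => - npow n (- 2^-1) * l%:R * \tr (resolvent_at M ^+ l.+1 *m E)).
Proof.
apply: (eq_smooth _ _ _ _ (smooth_mxtrace _ _ (msmooth_resolvent_atX l))) => // M E.
rewrite mxtraceZ raddf_sum /= -mulrA; congr (_ * _).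
rewrite (eq_bigr (fun=> \tr (resolvent_at M ^+ l.+1 *m E))).
  by rewrite sumr_const card_ord mulr_natl.
move=> i _; rewrite mxtrace_mulC mulmxA -[_ *m resolvent_at M ^+ _]exprD.
by rewrite addnS subnK// ltnW.
Qed.

Lemma smooth_gobs l : smooth (gobs l) (Dgobs l).
Proof.
have [->|l1] := eqVneq l 1%N.
  apply: (eq_smooth _ _ _ _ (smoothM _ _ _ _ (smooth_cst (npow n (- (2 / 3))))
    (smoothD _ _ _ _ (smooth_cst n%:R) (smooth_trX 1)))) => [M|M E].
    by rewrite /gobs eqxx expr1.
  by rewrite /Dgobs (_ : 2 * 1%:R / 3 = 2 / 3 :> R) ?mulr1//; ring.
apply: (eq_smooth _ _ _ _ (smoothM _ _ _ _ (smooth_cst (npow n (- (2 * l%:R / 3))))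
    (smooth_trX l))) => [M|M E].
  by rewrite /gobs (negPf l1).
by rewrite /Dgobs; ring.
Qed.

(* The offset [o] serves inductions on [K]; the product of [mK] is [gprod 0]. *)
Definition gprod o K M : R[i] := \prod_(i < size K) gobs (o + i).+1 M ^+ nth 0%N K i.

(** A zero component stays 0, which is harmless: the result is always multiplied by that
    component. *)
Definition dec_nth K i := set_nth 0%N K i (nth 0%N K i).-1.

(** [k_l Phi / g_l] is written as [k_l] times the product for [K - e_l], which avoids dividing by a
    possibly vanishing [g_l]. *)
Definition Dgprod o K M E : R[i] :=
  \sum_(i < size K) (nth 0%N K i)%:R * gprod o (dec_nth K i) M * Dgobs (o + i).+1 M E.

Lemma gprod_cons o k K M : gprod o (k :: K) M = gobs o.+1 M ^+ k * gprod o.+1 K M.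
Proof.
rewrite /gprod big_ord_recl /= addn0; congr (_ * _); apply: eq_bigr => i _.
by rewrite /bump /= add1n addnS addSn.
Qed.

Lemma smooth_gprod o K : smooth (gprod o K) (Dgprod o K).
Proof.
elim: K o => [|k K IH] o.
  by apply: (eq_smooth _ _ _ _ (smooth_cst 1)) => [M|M E];
    rewrite /gprod /Dgprod big_ord0.
apply: (eq_smooth _ _ _ _ (smoothM _ _ _ _ (smoothX _ _ k (smooth_gobs o.+1)) (IH o.+1)))
  => [M|M E].
  by rewrite gprod_cons.
rewrite /Dgprod /= big_ord_recl /= addn0 /dec_nth /= gprod_cons; congr (_ + _);
  first by ring.
rewrite mulr_sumr; apply: eq_bigr => i _;
  rewrite /bump /= add1n gprod_cons addnS addSn /dec_nth.
ring.
Qed.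

Lemma gprod_incr o K i M : gprod o (incr_nth K i) M = gobs (o + i).+1 M * gprod o K M.
Proof.
elim: K o i => [|k K IH] o i.
  elim: i o => [|i IHi] o.
    by rewrite /= gprod_cons addn0 expr1 /gprod !big_ord0.
  have -> : incr_nth [::] i.+1 = 0%N :: incr_nth [::] i by case: (i).
  rewrite gprod_cons expr0 mul1r IHi addSn addnS.
  by rewrite /gprod !big_ord0.
case: i => [|i] /=; rewrite !gprod_cons; first by rewrite addn0 exprS mulrA.
by rewrite IH addSn addnS mulrCA.
Qed.

Lemma trace_delta (A : Mat) (j k : 'I_n) : \tr (A *m delta_mx k j) = A j k.
Proof.
rewrite mxtrace_mulC /mxtrace (bigD1 k)//= big1 => [|i ik]; last first.
  rewrite mxE big1// => l _; rewrite mxE (negPf ik) mul0r //.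
rewrite addr0 mxE (bigD1 j)//= big1 => [|i ij]; rewrite mxE ?(negPf ij) ?andbF ?mul0r//.
by rewrite !eqxx mul1r addr0.
Qed.

Lemma mulmx_delta (A B : Mat) (j k : 'I_n) : (A *m delta_mx k j *m B) k j = A k k * B j j.
Proof.
rewrite mxE (bigD1 j)//= big1 => [|l lj].
  rewrite addr0 mxE (bigD1 k)//= big1 => [|l lk]; rewrite mxE ?(negPf lk) ?mulr0//.
  by rewrite !eqxx mulr1 addr0.
by rewrite mxE big1 ?mul0r// => p _; rewrite mxE (negPf lj) andbF mulr0.
Qed.

Definition dentry K (j k : 'I_n) M E : R[i] :=
  (- npow n (- 2^-1) *: (resolvent_at M *m E *m resolvent_at M)) k j * gprod 0 K M +
    resolvent_at M k j * Dgprod 0 K M E.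

Lemma smooth_entry K (j k : 'I_n) : smooth (fun M => resolvent_at M k j * gprod 0 K M)
  (dentry K j k).
Proof. exact: smoothM (msmooth_resolvent_at k j) (smooth_gprod 0 K). Qed.

Lemma sum_entry K M : selfadj M ->
  npow n (- 2^-1) * (\sum_j \sum_k M j k * (resolvent_at M k j * gprod 0 K M)) =
  (n%:R + w * \tr (resolvent_at M)) * gprod 0 K M.
Proof.
move=> hM.
have u : npow n (- 2^-1) *: M - w%:M \in unitmx.
  by apply: resolvent_unit; [exact: (selfadjZ _ s)|exact: Imw].
have -> : n%:R + w * \tr (resolvent_at M) = npow n (- 2^-1) * \tr (M *m resolvent_at M).
  have := mulmxV u; rewrite -/(resolvent_at M) mulmxBl mul_scalar_mx -scalemxAl => /eqP.
  rewrite subr_eq => /eqP/(congr1 (@mxtrace _ _));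
    rewrite !(mxtraceZ, mxtraceD) mxtrace1 => ->.
  by [].
rewrite -mulrA; congr (_ * _); rewrite mulr_suml; apply: eq_bigr => j _.
by rewrite mxE mulr_suml; apply: eq_bigr => k _; rewrite mulrA.
Qed.

(** For [E = e_kj] the entry [(G E G)_kj] is [G_kk G_jj], which sums to [(Tr G)^2], and
    [G_kj (G^(l+1))_jk] sums to [Tr G^(l+2)]. The prefactor and the derivative each carry
    [n^(-1/2)], hence [n^-1 = q^-3]. *)
Lemma sum_dentry K M :
  npow n (- 2^-1) * (\sum_j \sum_k dentry K j k M (delta_mx k j)) =
  - (q ^+ 3)^-1 *
    (\tr (resolvent_at M) ^+ 2 * gprod 0 K M + \sum_(i < size K) (nth 0%N K i)%:R * gprod
      0 (dec_nth K i) M *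
      (npow n (- (2 * i.+1%:R / 3)) * i.+1%:R * \tr (resolvent_at M ^+ i.+3))).
Proof.
have E j k : dentry K j k M (delta_mx k j) = - npow n (- 2^-1) *
   (resolvent_at M k k * resolvent_at M j j * gprod 0 K M +
    \sum_(i < size K) (nth 0%N K i)%:R * gprod 0 (dec_nth K i) M *
      (npow n (- (2 * i.+1%:R / 3)) * i.+1%:R * (resolvent_at M k j * (resolvent_at M ^+
        i.+2) j k))).
  rewrite /dentry mxE mulmx_delta mulrDr; congr (_ + _); first by ring.
  rewrite /Dgprod !mulr_sumr; apply: eq_bigr => i _.
  by rewrite /Dgobs add0n trace_delta; ring.
under eq_bigr do under eq_bigr do rewrite E.
under eq_bigr do rewrite -mulr_sumr.
rewrite -mulr_sumr mulrA mulrN -expr2 sqr_npow_half; congr (_ * _).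
under eq_bigr do rewrite big_split.
rewrite big_split; congr (_ + _).
  rewrite expr2 /mxtrace !mulr_suml; apply: eq_bigr => j _.
  by rewrite mulr_sumr mulr_suml; apply: eq_bigr => k _; ring.
rewrite exchange_big /=.
under eq_bigr do rewrite exchange_big.
rewrite exchange_big /=; apply: eq_bigr => i _.
under eq_bigr do rewrite -mulr_sumr.
rewrite -mulr_sumr; congr (_ * _).
under eq_bigr do rewrite -mulr_sumr.
rewrite -mulr_sumr; congr (_ * _).
rewrite [resolvent_at M ^+ i.+3]exprS; apply: eq_bigr => k _.
by rewrite mxE.
Qed.

(* Everything is a power of [q = n^(1/3)]: the terms of order [q^3] and [q^2] cancel
   because the spectral parameter is at the edge 2. *)
Lemma loop_pointwise K M :
  (n%:R + w * \tr (resolvent_at M)) * gprod 0 K M + (q ^+ 3)^-1 *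
    (\tr (resolvent_at M) ^+ 2 * gprod 0 K M + \sum_(i < size K) (nth 0%N K i)%:R * gprod
      0 (dec_nth K i) M *
      (npow n (- (2 * i.+1%:R / 3)) * i.+1%:R * \tr (resolvent_at M ^+ i.+3))) =
  q * (- z * gprod 0 K M + z * npow n (- 3^-1) * gprod 0 (incr_nth K 0) M
    + gprod 0 (incr_nth (incr_nth K 0) 0) M
    + \sum_(i < size K) (i.+1 * nth 0%N K i)%:R * gprod 0 (incr_nth (dec_nth K i) i.+2) M).
Proof.
have q0 := npow_third_neq0.
rewrite !gprod_incr.
have -> : npow n (- 3^-1) = q^-1 by have := npow_thirds 1; rewrite mul1r expr1.
have trE : \tr (resolvent_at M) = q ^+ 2 * gobs 1 M - q ^+ 3.
  by rewrite /gobs eqxx npow23 cube_npow_third; field.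
(* With [l = i.+1]: [q^-3 q^(-2l) = q q^(-2(l+2))], which is [q] times the normalization of
   [g_(l+2)]. As [l + 2] is never 1, no centering occurs. *)
have sE : (q ^+ 3)^-1 *
      (\sum_(i < size K) (nth 0%N K i)%:R * gprod 0 (dec_nth K i) M *
      (npow n (- (2 * i.+1%:R / 3)) * i.+1%:R * \tr (resolvent_at M ^+ i.+3))) =
  q * \sum_(i < size K) (i.+1 * nth 0%N K i)%:R * gprod 0 (incr_nth (dec_nth K i) i.+2) M.
  rewrite !mulr_sumr; apply: eq_bigr => i _; rewrite gprod_incr add0n /gobs /=.
  rewrite !npow2l natrM; have -> : (2 * i.+3 = 2 * i.+1 + 4)%N by lia.
  by rewrite exprD; field; rewrite q0 expf_neq0.
rewrite mulrDr sE trE /w npow23 -cube_npow_third; field; exact: q0.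
Qed.
End Observables.

Section LoopEquation.
Context {R : realType} {d : measure_display} {T : measurableType d} {P : probability T R}.
Context {n : nat} (x y : 'I_n -> 'I_n -> {RV P >-> R}) (z : R[i]).
Hypothesis xyGUE : is_GUE x y.
Hypothesis n_gt0 : (0 < n)%N.
Hypothesis Imz : complex.Im z != 0.
Local Notation M := (gue_mx x y).

Lemma cintegrable_smooth (F : 'M[R[i]]_n -> R[i]) DF : smooth F DF ->
  cintegrable P (fun t => F (M t)).
Proof.
move=> sF; have [K bK] := smooth_line F DF _ sF (selfadj_herm_of (fun=> 0)).
apply: (cintegrable_bounded _ _ K); first by apply: cmeasurable_gue; have [] := sF.
by move=> t; have [] := bK _ (selfadj_gue x y t).
Qed.

Lemma gfunE l t : gfun x y z l t = gobs z l (M t).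
Proof.
have resE : resolvent x y z t = resolvent_at z (M t).
  rewrite /resolvent /resolvent_at; congr (invmx (_ - _)).
  by rewrite (gue_mxE x y xyGUE); apply/matrixP => j k; rewrite !mxE.
by rewrite /gfun /gobs resE.
Qed.

Lemma mKE K : mK x y z K = cexpect P (fun t => gprod z 0 K (M t)).
Proof.
have E : (fun t => \prod_(i < size K) gfun x y z i.+1 t ^+ nth 0%N K i) =
    (fun t => gprod z 0 K (M t)).
  apply/funext => t; rewrite /gprod; apply: eq_bigr => i _.
  by rewrite add0n (gfunE i.+1 t).
exact: (congr1 (cexpect P) E).
Qed.

Lemma cintegrable_gprod K : cintegrable P (fun t => gprod z 0 K (M t)).
Proof. exact: cintegrable_smooth (smooth_gprod z n_gt0 Imz 0 K). Qed.

(** The difference of the two sides of the summed integration by parts is rewritten pointwise as [q]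
    times the recursion, before expectations are split; [q] is then cancelled, being nonzero for
    [n > 0]. *)
Lemma loop_equation K :
  mK x y z K * z - mK x y z (madd_e (madd_e K 1) 1)
    - \sum_(1 <= l < (size K).+1) (l * mcomp K l)%:R * mK x y z (madd_e (msub_e K l) l.+2)
  = z * npow n (- 3^-1) * mK x y z (madd_e K 1).
Proof.
pose s : R[i] := npow n (- 2^-1); pose w : R[i] := 2 + z * npow n (- (2 / 3)).
pose ent j k t := M t j k * (resolvent_at z (M t) k j * gprod z 0 K (M t)).
pose dent j k t := dentry z K j k (M t) (delta_mx k j).
have ibp j k : [/\ cintegrable P (ent j k), cintegrable P (dent j k) &
    cexpect P (ent j k) = cexpect P (dent j k)].
  exact: ibp_entry (smooth_entry z n_gt0 Imz K j k).
have ient j k : cintegrable P (ent j k) by have [] := ibp j k.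
have ident j k : cintegrable P (dent j k) by have [] := ibp j k.
have iE (F : 'I_n -> 'I_n -> T -> R[i]) : (forall j k, cintegrable P (F j k)) ->
    cintegrable P (fun t => s * \sum_j \sum_k F j k t) /\
    cexpect P (fun t => s * \sum_j \sum_k F j k t) = s * \sum_j \sum_k cexpect P (F j k).
  move=> iF; have i1 j : cintegrable P (fun t => \sum_k F j k t) by exact: cintegrable_sum.
  have i2 : cintegrable P (fun t => \sum_j \sum_k F j k t) by exact: cintegrable_sum.
  split; first exact: cintegrableZ.
  rewrite cexpectZ//; congr (_ * _); rewrite cexpect_sum//; apply: eq_bigr => j _.
  by rewrite cexpect_sum.
have [iA EA] := iE _ ient; have [iB EB] := iE _ ident.
have EAB : cexpect P (fun t => s * (\sum_j \sum_k ent j k t) + -1 * (s * \sum_j \sum_k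
  dent j k t)) = 0.
  rewrite cexpectD//; last exact: cintegrableZ.
  rewrite EA cexpectZ// EB mulN1r; apply/eqP; rewrite subr_eq0; apply/eqP.
  congr (_ * _); apply: eq_bigr => j _; apply: eq_bigr => k _; by have [] := ibp j k.
pose q : R[i] := npow n (3^-1).
pose m K' t := gprod z 0 K' (M t).
have iZ c K' : cintegrable P (fun t => c * m K' t) by apply: cintegrableZ;
  exact: cintegrable_gprod.
pose S t := \sum_(i < size K) (i.+1 * nth 0%N K i)%:R * m (incr_nth (dec_nth K i) i.+2) t.
have iS : cintegrable P S by apply: cintegrable_sum => i; exact: iZ.
have pw : (fun t => s * (\sum_j \sum_k ent j k t) + -1 * (s * \sum_j \sum_k dent j k t)) =
    (fun t => q * ((- z * m K t + z * npow n (- 3^-1) * m (incr_nth K 0) t)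
      + (1 * m (incr_nth (incr_nth K 0) 0) t + S t))).
  apply/funext => t; rewrite /ent /dent /s.
  rewrite (sum_entry z n_gt0 Imz K (M t) (selfadj_gue x y t)) (sum_dentry z K (M t)).
  rewrite mulN1r mulNr opprK (loop_pointwise z n_gt0 Imz K (M t)) /S /m.
  by rewrite mul1r addrA.
have i1 := cintegrableD P _ _ (iZ (- z) K) (iZ (z * npow n (- 3^-1)) (incr_nth K 0)).
have i2 := cintegrableD P _ _ (iZ 1 (incr_nth (incr_nth K 0) 0)) iS.
move: EAB; rewrite pw cexpectZ; last exact: cintegrableD.
move/eqP; rewrite mulf_eq0 (negPf (npow_third_neq0 n_gt0))/=.
rewrite cexpectD// cexpectD// cexpectD// !cexpectZ; try exact: cintegrable_gprod.
rewrite mul1r -!mKE => /eqP E.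
have SE : cexpect P S = \sum_(1 <= l < (size K).+1)
    (l * mcomp K l)%:R * mK x y z (madd_e (msub_e K l) l.+2).
  (* The index [i] is [l.-1], so [dec_nth K i] is [msub_e K l] and the increment at position [i.+2]
     is [madd_e _ l.+2]. *)
  rewrite big_add1 big_mkord cexpect_sum => [|i]; last exact: iZ.
  by apply: eq_bigr => i _; rewrite cexpectZ ?mKE//; exact: cintegrable_gprod.
rewrite -SE /madd_e /=; apply/eqP; rewrite -subr_eq0 -oppr_eq0 -[X in _ == X]E.
by apply/eqP; ring.
Qed.
End LoopEquation.

Theorem theorem1p2 (R : realType) (d : measure_display) (T : measurableType d)
  (P : probability T R)
  (x y : forall n : nat, 'I_n -> 'I_n -> {RV P >-> R}) :
  (forall n, is_GUE (x n) (y n)) ->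
  forall z : R[i], complex.Im z != 0 ->
  (forall K : seq nat, has (fun k => k != 0%N) K ->
    exists (C : R) (N : nat), forall n, (N <= n)%N ->
      exists (d0 d1 d3 : R[i]) (d2 : nat -> R[i]),
        [/\ Normc.normc d0 <= C * (n%:R `^ (-(2/3))),
            Normc.normc d1 <= C * (n%:R `^ (-(2/3))),
            (forall l, Normc.normc (d2 l) <= C * (n%:R `^ (-(2/3)))),
            Normc.normc d3 <= C * (n%:R `^ (-(3^-1))) &
            mK (x n) (y n) z K * (z + d0)
            - mK (x n) (y n) z (madd_e (madd_e K 1) 1) * (1 + d1)
            - \sum_(1 <= l < (size K).+1)
                 (l * mcomp K l)%:R
                 * mK (x n) (y n) z (madd_e (msub_e K l) l.+2) * (1 + d2 l)
            = d3 * mK (x n) (y n) z (madd_e K 1)]) /\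
  (exists (C : R) (N : nat), forall n, (N <= n)%N ->
      exists (d0 d1 d3 : R[i]),
        [/\ Normc.normc d0 <= C * (n%:R `^ (-(2/3))),
            Normc.normc d1 <= C * (n%:R `^ (-(2/3))),
            Normc.normc d3 <= C * (n%:R `^ (-(3^-1))) &
            z + d0 - mK (x n) (y n) z [:: 2%N] * (1 + d1)
            = d3 * mK (x n) (y n) z [:: 1%N]]).
Proof.
(* [z n^(-1/3)] has modulus exactly [C n^(-1/3)] with [C = |z|]; all other error terms will be 0,
   and the threshold [N = 1] ensures [n > 0]. *)
move=> xyGUE z Imz; pose C : R := Normc.normc z.
have C0 (n : nat) a : Normc.normc 0 <= C * n%:R `^ a.
  by rewrite Normc.normc0 mulr_ge0 ?powR_ge0 ?normc_ge0.
have C3 (n : nat) : Normc.normc (z * npow n (- 3^-1)) <= C * n%:R `^ (- 3^-1).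
  by rewrite Normc.normcM normcR ger0_norm ?powR_ge0.
split=> [K _|]; exists C, 1%N => n n0; have loop := loop_equation _ _ z (xyGUE n) n0 Imz.
- exists 0, 0, (z * npow n (- 3^-1)), (fun=> 0); split=> //.
  rewrite -loop !addr0 mulr1; congr (_ - _).
  by apply: eq_bigr => l _; rewrite mulr1.
- exists 0, 0, (z * npow n (- 3^-1)); split=> //.
  (* The recursion at the empty multi-index, whose product is 1 and whose sum over [l] is empty. *)
  have := loop [::]; rewrite big_geq// subr0 /madd_e /= => <-.
  have -> : mK (x n) (y n) z [::] = 1.
    rewrite -[RHS](cexpect_cst P 1); congr (cexpect P _); apply/funext => t.
    by rewrite big_ord0.
  by rewrite mul1r !addr0 mulr1.
Qed.
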